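(* Let $(X,g)$ be a multi-Eguchi--Hanson or a multi-Taub--NUT space with singular points $p_1,\dots,p_k$ of $\phi$. Then every compact minimal hypersurface of $X$ is contained in $$\pi^{-1}\Big(\{x\in \mathbb{R}^3: |x|\le \tfrac43\max_i|p_i|\}\Big).$$ Moreover, there are no compact minimal hypersurfaces contained in $$\pi^{-1}\Big(\{x\in \mathbb{R}^3: |x|<\min\{|p_i|: |p_i|>0\}\}\Big).$$
   Context: Multi-Eguchi--Hanson and multi-Taub--NUT spaces: let $p_1,\dots,p_k$ be distinct points of $\mathbb{R}^3$ ($k\ge 1$), let $m\ge 0$, let $U=\mathbb{R}^3\setminus\{p_1,\dots,p_k\}$, and let $\phi(x)=m+\sum_{i=1}^k \frac{1}{2|x-p_i|}$ on $U$. Let $\pi:X_0\to U$ be the principal $S^1$-bundle (with $S^1=\mathbb{R}/2\pi\mathbb{Z}$) carrying a connection $1$-form $\eta$ (that is, $\eta$ is $S^1$-invariant and $\eta(\xi)=1$, with $\xi$ the infinitesimal generator of the action) such that $d\eta=\pi^*( *_{\mathbb{R}^3}d\phi)$, and put $g=\phi^{-1}\eta^2+\phi\,\pi^*g_{\mathbb{R}^3}$. Adding one point over each $p_i$ yields a smooth complete hyperkähler $4$-manifold $(X,g)$ to which the $S^1$-action extends (fixing the added points), and $\pi$ extends to $\pi:X\to\mathbb{R}^3$. It is called a multi-Eguchi--Hanson space if $m=0$ and a multi-Taub--NUT space if $m>0$; the $p_i$ are called the singular points of $\phi$. $|\cdot|$ is the Euclidean norm on $\mathbb{R}^3$. A hypersurface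 is a $3$-dimensional submanifold without boundary; minimal means vanishing mean curvature vector. The minimum of the empty set is $+\infty$. *)

(* Defs.v *)
From HB Require Import structures.
From mathcomp Require Import all_boot all_order all_algebra.
From mathcomp Require Import all_classical all_reals all_analysis.

Set Implicit Arguments.
Unset Strict Implicit.
Unset Printing Implicit Defensive.

Import Order.TTheory GRing.Theory Num.Theory.
Import numFieldNormedType.Exports.

Local Open Scope classical_set_scope.
Local Open Scope ring_scope.

(* C^oo on an open set D of a finite-dimensional space: every iterated
   directional derivative is differentiable at every point of D. *)
Definition smooth_on (R : realType) (V W : normedModType R)
    (D : set V) (f : V -> W) : Prop :=
  forall (vs : seq V) (x : V), D x ->
    differentiable (foldr (fun v (h : V -> W) => fun y => 'D_v h y) f vs) x.

Definition pderiv (R : realType) (n : nat) (W : normedModType R) (i : 'I_n)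
    (f : 'rV[R]_n -> W) (x : 'rV[R]_n) : W :=
  'D_(delta_mx 0 i) f x.

(* The norm `|x| on 'rV[R]_n is the sup norm. *)
Definition enorm (R : realType) (n : nat) (x : 'rV[R]_n) : R :=
  Num.sqrt (\sum_i x 0 i ^+ 2).

(* A homeomorphism from an open set of X onto an open set of R^n; the values of
   [cmap] outside [cdom], and of [cinv] outside [cimg], are irrelevant. *)
Record chart (R : realType) (n : nat) (X : topologicalType) := Chart {
  cdom : set X;
  cmap : X -> 'rV[R]_n;
  cinv : 'rV[R]_n -> X;
  cdom_open : open cdom;
  cimg_open : open (cmap @` cdom);
  cmapK : forall x, cdom x -> cinv (cmap x) = x;
  cmap_cont : {within cdom, continuous cmap};
  cinv_cont : {within cmap @` cdom, continuous cinv}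
}.

Definition cimg (R : realType) (n : nat) (X : topologicalType)
    (c : chart R n X) : set 'rV[R]_n := cmap c @` cdom c.

Definition compatible (R : realType) (n : nat) (X : topologicalType)
    (c d : chart R n X) : Prop :=
  smooth_on (cmap c @` (cdom c `&` cdom d)) (cmap d \o cinv c) /\
  smooth_on (cmap d @` (cdom c `&` cdom d)) (cmap c \o cinv d).

Record manifold (R : realType) (n : nat) := Manifold {
  carrier :> topologicalType;
  mfd_hausdorff : hausdorff_space carrier;
  mfd_second_countable : @second_countable carrier;
  atlas : set (chart R n carrier);
  atlas_cover : forall x, exists2 c, atlas c & cdom c x;
  atlas_compat : forall c d, atlas c -> atlas d -> compatible c d;
  atlas_maximal : forall c, (forall d, atlas d -> compatible c d) -> atlas c
}.

(* Smoothness on the open set O of a map from a manifold to a vector space. *)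
Definition smooth_from (R : realType) (n : nat) (X : manifold R n)
    (W : normedModType R) (O : set X) (f : X -> W) : Prop :=
  forall c, atlas c -> smooth_on (cmap c @` (cdom c `&` O)) (f \o cinv c).

(* Smoothness on the open set D of a map from a vector space to a manifold. *)
Definition smooth_to (R : realType) (n : nat) (X : manifold R n)
    (V : normedModType R) (D : set V) (f : V -> X) : Prop :=
  {within D, continuous f} /\
  forall c, atlas c -> smooth_on (D `&` f @^-1` cdom c) (cmap c \o f).

(* Jacobians follow the row-vector convention of the library:
   ('J f y) i j = d_i f_j, and df_y (v) = v *m 'J f y. *)
Definition transition_jac (R : realType) (n : nat) (X : manifold R n)
    (c d : chart R n X) (x : X) : 'M[R]_n :=
  'J (cmap d \o cinv c) (cmap c x).

(* [gmat c x] is the matrix of g at x in the coordinates of the chart c. *)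
Record riemannian_metric (R : realType) (n : nat) (X : manifold R n) :=
  RiemannianMetric {
  gmat : chart R n X -> X -> 'M[R]_n;
  gmat_change : forall c d x, atlas c -> atlas d -> cdom c x -> cdom d x ->
    gmat c x = transition_jac c d x *m gmat d x *m (transition_jac c d x)^T;
  gmat_smooth : forall c, atlas c -> smooth_on (cimg c) (gmat c \o cinv c);
  gmat_sym : forall c x, atlas c -> cdom c x -> (gmat c x)^T = gmat c x;
  gmat_pos : forall c x (v : 'rV[R]_n), atlas c -> cdom c x -> v != 0 ->
    0 < (v *m gmat c x *m v^T) 0 0
}.

(* A smooth 1-form on the open set O; [w c x] is the column of its components
   at x in the coordinates of the chart c. *)
Definition one_form (R : realType) (n : nat) (X : manifold R n) (O : set X)
    (w : chart R n X -> X -> 'cV[R]_n) : Prop :=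
  (forall c d x, atlas c -> atlas d -> O x -> cdom c x -> cdom d x ->
     w c x = transition_jac c d x *m w d x) /\
  (forall c, atlas c ->
     smooth_on (cmap c @` (cdom c `&` O)) (w c \o cinv c)).

(* (dw)_ij = d_i w_j - d_j w_i *)
Definition ext_deriv (R : realType) (n : nat) (X : manifold R n)
    (w : chart R n X -> X -> 'cV[R]_n) (c : chart R n X) (x : X) : 'M[R]_n :=
  \matrix_(i, j)
    (pderiv i (fun y => w c (cinv c y) j 0) (cmap c x)
     - pderiv j (fun y => w c (cinv c y) i 0) (cmap c x)).

(* Christoffel symbol Gamma^a_ij of the Levi-Civita connection. *)
Definition christoffel (R : realType) (n : nat) (X : manifold R n)
    (g : riemannian_metric X) (c : chart R n X) (x : X) (i j a : 'I_n) : R :=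
  let dg l i j :=
    pderiv l (fun y => gmat g c (cinv c y) i j) (cmap c x) in
  2^-1 * \sum_l invmx (gmat g c x) a l * (dg i j l + dg j i l - dg l i j).

(* The chart c identifies S with the coordinate hyperplane {y_n = 0}. *)
Definition slice_chart (R : realType) (n : nat) (X : manifold R n.+1)
    (S : set X) (c : chart R n.+1 X) : Prop :=
  atlas c /\ forall x, cdom c x -> (S x <-> cmap c x 0 ord_max = 0).

(* Embedded submanifold of codimension 1, without boundary. *)
Definition hypersurface (R : realType) (n : nat) (X : manifold R n.+1)
    (S : set X) : Prop :=
  forall x, S x -> exists2 c, slice_chart S c & cdom c x.

(* In a slice chart, the rows of [tangent_frame] are the coordinate vectors
   d_0, ..., d_(n-1) of S. *)
Definition tangent_frame (R : realType) (n : nat) : 'M[R]_(n, n.+1) :=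
  \matrix_(i, j) (j == lift ord_max i)%:R.

Definition induced_metric (R : realType) (n : nat) (X : manifold R n.+1)
    (g : riemannian_metric X) (c : chart R n.+1 X) (x : X) : 'M[R]_n :=
  tangent_frame R n *m gmat g c x *m (tangent_frame R n)^T.

(* g-orthogonal projection onto the normal space of S. *)
Definition normal_part (R : realType) (n : nat) (X : manifold R n.+1)
    (g : riemannian_metric X) (c : chart R n.+1 X) (x : X)
    (v : 'rV[R]_n.+1) : 'rV[R]_n.+1 :=
  v - v *m gmat g c x *m (tangent_frame R n)^T
        *m invmx (induced_metric g c x) *m tangent_frame R n.

(* II(d_i, d_j) is the normal part of the covariant derivative of d_j along
   d_i, which is sum_a Gamma^a_ij d_a. *)
Definition second_fund_form (R : realType) (n : nat) (X : manifold R n.+1)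
    (g : riemannian_metric X) (c : chart R n.+1 X) (x : X) (i j : 'I_n) :
    'rV[R]_n.+1 :=
  normal_part g c x
    (\row_a christoffel g c x (lift ord_max i) (lift ord_max j) a).

(* Mean curvature vector, in the coordinates of a slice chart c. *)
Definition mean_curvature (R : realType) (n : nat) (X : manifold R n.+1)
    (g : riemannian_metric X) (c : chart R n.+1 X) (x : X) : 'rV[R]_n.+1 :=
  \sum_i \sum_j
    invmx (induced_metric g c x) i j *: second_fund_form g c x i j.

Definition minimal (R : realType) (n : nat) (X : manifold R n.+1)
    (g : riemannian_metric X) (S : set X) : Prop :=
  forall c x, slice_chart S c -> cdom c x -> S x -> mean_curvature g c x = 0.

Definition compact_minimal_hypersurface (R : realType) (n : nat)
    (X : manifold R n.+1) (g : riemannian_metric X) (S : set X) : Prop :=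
  [/\ hypersurface S, compact S & minimal g S].

(* A smooth action of the circle R / 2 pi Z, as a 2 pi-periodic action of R. *)
Record circle_action (R : realType) (n : nat) (X : manifold R n)
    (act : R -> X -> X) : Prop := CircleAction {
  act0 : forall x, act 0 x = x;
  actD : forall s t x, act (s + t) x = act s (act t x);
  act2pi : forall x, act (2 * pi) x = x;
  act_smooth : forall c, atlas c ->
    smooth_to [set ty : R * 'rV[R]_n | cimg c ty.2]
      (fun ty => act ty.1 (cinv c ty.2))
}.

(* Coordinates in the chart c of the infinitesimal generator of the action. *)
Definition generator (R : realType) (n : nat) (X : manifold R n)
    (act : R -> X -> X) (c : chart R n X) (x : X) : 'rV[R]_n :=
  derive1 (fun t : R => cmap c (act t x)) 0.

(* Equivariant local triviality over the open set U of R^b: near each point of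
   U, the map (y, t) |-> h (y, t) induces a diffeomorphism from V x S^1 onto the
   preimage of V, with inverse x |-> (proj x, (zc x, zs x)), where S^1 is seen
   as the unit circle of R^2. *)
Definition principal_circle_bundle (R : realType) (n b : nat)
    (X : manifold R n) (act : R -> X -> X) (proj : X -> 'rV[R]_b)
    (U : set 'rV[R]_b) : Prop :=
  smooth_from (proj @^-1` U) proj /\
  forall u, U u -> exists V : set 'rV[R]_b,
    [/\ open V, V u, V `<=` U &
      exists (h : 'rV[R]_b * R -> X) (zc zs : X -> R),
      [/\ smooth_to [set yt : 'rV[R]_b * R | V yt.1] h,
          smooth_from (proj @^-1` V) zc,
          smooth_from (proj @^-1` V) zs,
          (forall y t, V y ->
             [/\ proj (h (y, t)) = y, zc (h (y, t)) = cos t,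
                 zs (h (y, t)) = sin t &
                 forall s, act s (h (y, t)) = h (y, s + t)]) &
          (forall x, V (proj x) -> exists t, x = h (proj x, t))]].

(* A connection 1-form on O, an open set stable under the action. *)
Record connection_form (R : realType) (n : nat) (X : manifold R n)
    (act : R -> X -> X) (O : set X)
    (eta : chart R n X -> X -> 'cV[R]_n) : Prop := ConnectionForm {
  conn_form : one_form O eta;
  conn_invariant : forall t c d x, atlas c -> atlas d -> O x ->
    cdom c x -> cdom d (act t x) ->
    eta c x = 'J (cmap d \o act t \o cinv c) (cmap c x) *m eta d (act t x);
  conn_generator : forall c x, atlas c -> O x -> cdom c x ->
    (generator act c x *m eta c x) 0 0 = 1
}.

Definition gh_potential (R : realType) (k : nat) (p : 'I_k -> 'rV[R]_3) (m : R)
    (x : 'rV[R]_3) : R :=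
  m + \sum_i (2 * enorm (x - p i))^-1.

(* The Hodge dual in R^3 of df, as an antisymmetric matrix: indices being taken
   in Z/3, the entry (a, a + 1) is d_(a + 2) f. *)
Definition hodge_d (R : realType) (f : 'rV[R]_3 -> R) (x : 'rV[R]_3) :
    'M[R]_3 :=
  \matrix_(a, b) ((b == a + 1)%:R * pderiv (a + 2) f x
                  - (a == b + 1)%:R * pderiv (b + 2) f x).

Definition chart_jac (R : realType) (n b : nat) (X : manifold R n)
    (proj : X -> 'rV[R]_b) (c : chart R n X) (x : X) : 'M[R]_(n, b) :=
  'J (proj \o cinv c) (cmap c x).

(* (X, g) is obtained by the Gibbons-Hawking construction from the potential
   with constant m and poles p, with one point added over each pole. *)
Record gibbons_hawking (R : realType) (k : nat) (p : 'I_k -> 'rV[R]_3) (m : R)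
    (X : manifold R 4) (g : riemannian_metric X) (proj : X -> 'rV[R]_3)
    (act : R -> X -> X) (eta : chart R 4 X -> X -> 'cV[R]_4) : Prop :=
  GibbonsHawking {
  gh_poles : (0 < k)%N;
  gh_distinct : injective p;
  gh_action : circle_action act;
  gh_proj_cont : continuous proj;
  gh_bundle : principal_circle_bundle act proj (~` range p);
  gh_added : forall i, exists x, proj @^-1` [set p i] = [set x];
  gh_fixed : forall x t, range p (proj x) -> act t x = x;
  gh_connection : connection_form act (proj @^-1` (~` range p)) eta;
  gh_curvature : forall c x, atlas c -> cdom c x -> ~ range p (proj x) ->
    ext_deriv eta c x =
    chart_jac proj c x *m hodge_d (gh_potential p m) (proj x)
      *m (chart_jac proj c x)^T;
  gh_metric : forall c x, atlas c -> cdom c x -> ~ range p (proj x) ->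
    gmat g c x =
    (gh_potential p m (proj x))^-1 *: (eta c x *m (eta c x)^T)
    + gh_potential p m (proj x) *: (chart_jac proj c x *m (chart_jac proj c x)^T)
}.

Definition multi_Eguchi_Hanson (R : realType) (k : nat) (p : 'I_k -> 'rV[R]_3)
    (X : manifold R 4) (g : riemannian_metric X) (proj : X -> 'rV[R]_3) : Prop :=
  exists act eta, gibbons_hawking p 0 g proj act eta.

Definition multi_Taub_NUT (R : realType) (k : nat) (p : 'I_k -> 'rV[R]_3)
    (X : manifold R 4) (g : riemannian_metric X) (proj : X -> 'rV[R]_3) : Prop :=
  exists2 m : R, 0 < m & exists act eta, gibbons_hawking p m g proj act eta.

(* Main.v *)
Require Import Defs.
From HB Require Import structures.
From mathcomp Require Import all_boot all_order all_algebra.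
From mathcomp Require Import all_classical all_reals all_analysis.
From mathcomp Require Import ring lra.
Import Order.TTheory GRing.Theory Num.Theory.
Import numFieldNormedType.Exports.
Local Open Scope classical_set_scope.
Local Open Scope ring_scope.

(** Let [u = proj x] and [phi] be the potential, and let [x] maximise [|u|^2]
    on a compact minimal hypersurface [S].  If [x] lies over no pole and
    [u != 0], then [T_x S] is the kernel of the differential of [|u|^2], and
    minimality makes the trace over [T_x S] of the second derivatives of
    [|u|^2 / 2] equal to the trace of its Hessian for [g].  The latter is
    [(4 phi + u . grad phi) / (2 phi^2)], so the maximum forces
    [4 phi + u . grad phi <= 0].  A pole at [q] contributes
    [(3 |u|^2 - 7 u . q + 4 |q|^2) / (2 |u - q|^3)] to [4 phi + u . grad phi],
    with numerator at least [(3 |u| - 4 |q|) (|u| - |q|)] by Cauchy-Schwarz: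
    this is positive when [|u| < |q|] or [|u| > 4/3 |q|].
    If [u = 0], then [S] lies in a fibre of [proj], which has dimension at
    most one. *)

(** * Second derivatives *)

Lemma is_derive_line {R : realType} {V W : normedModType R} (f : V -> W)
    (a v : V) (t : R) (l : W) :
  is_derive (a + t *: v) v f l -> is_derive t 1 (fun s => f (a + s *: v)) l.
Proof.
have E : (fun h : R => h^-1 *: (f (a + (h *: 1 + t) *: v) - f (a + t *: v))) =
    (fun h => h^-1 *: (f (h *: v + (a + t *: v)) - f (a + t *: v))).
  by apply/funext => h; rewrite [h%:A]mulr1 scalerDl addrCA.
move=> [dfv <-]; apply: DeriveDef; first by rewrite /derivable /= E.
by rewrite /derive /= E.
Qed.

(** If the second derivative were positive, the first derivative, which vanishes at 0, would be
    positive just to the right of 0. By the mean value theorem [q] would then exceed [q 0] there. *)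
Lemma second_derivative_at_max {R : realType} (q : R -> R) :
  (\forall t \near 0, derivable q t 1) -> derivable (derive1 q) 0 1 ->
  (\forall t \near 0, q t <= q 0) ->
  (derive1 q) 0 = 0 /\ (derive1 (derive1 q)) 0 <= 0.
Proof.
move=> dq ddq qmax.
have /nbhs_ballP[e /= e0 He] :
    \forall t \near 0, derivable q t 1 /\ q t <= q 0.
  by near=> t; split; near: t.
have inball t : t \in `]-e, e[ -> derivable q t 1 /\ q t <= q 0.
  rewrite in_itv/= => te; apply: He.
  by rewrite /ball/= sub0r normrN ltr_norml.
have q'0 : is_derive (0 : R) 1 q 0.
  apply: (@derive1_at_max _ _ (-e) e).
  - by rewrite ge0_cp// ltW.
  - by move=> t /inball[].
  - by rewrite in_itv/= oppr_lt0 e0.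
  - by move=> t /inball[].
have q'00 : (derive1 q) 0 = 0 by rewrite derive1E derive_val.
split=> //; rewrite leNgt; apply/negP => L0.
have /cvgr_gt/(_ 0 L0) : (fun h : R => h^-1 *: ((derive1 q) (h + 0) - (derive1 q) 0))
    @ 0^' --> (derive1 (derive1 q)) 0.
  have E : (fun h : R => h^-1 *: (derive1 q (h *: 1 + 0) - derive1 q 0)) =
    (fun h : R => h^-1 *: (derive1 q (h + 0) - derive1 q 0)).
    by apply/funext => h; rewrite [h%:A]mulr1.
  have : is_derive (0 : R) (1 : R) (derive1 q) (derive1 (derive1 q) 0).
    by rewrite derive1E; exact: derivableP.
  move=> [dd <-]; rewrite /derive -E; exact: dd.
move=> /nbhs_ballP[d /= d0 Hd].
(* [b] lies inside both balls: [q] is derivable with [q t <= q 0] up to [b], and the quotient of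
   [derive1 q] is positive up to [b]. *)
pose b := Num.min e d / 2.
have b0 : 0 < b by rewrite divr_gt0// lt_min e0.
have be : b < e /\ b < d.
  have : b < Num.min e d by rewrite /b ltr_pdivrMr// mulr_natr mulr2n ltrDl lt_min e0.
  by rewrite lt_min => /andP.
have qd t : 0 <= t <= b -> derivable q t 1.
  move=> /andP[t0 tb]; apply: (inball t _).1.
  by rewrite in_itv/= (lt_le_trans _ t0) ?oppr_lt0//= (le_lt_trans tb) ?be.1.
have [| |c] := @MVT R q (derive1 q) 0 b b0.
- move=> t /[!in_itv]/= /andP[t0 tb]; rewrite derive1E; apply: derivableP.
  by apply: qd; rewrite !ltW.
- apply: derivable_within_continuous => t.
  by rewrite in_itv/=; exact: qd.
rewrite in_itv/= => /andP[c0 cb]; rewrite subr0 => qE.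
have := Hd c; rewrite /ball/= sub0r normrN gtr0_norm// (lt_trans cb be.2).
move=> /(_ isT) /(_ (lt0r_neq0 c0)); rewrite addr0 q'00 subr0 /= => c'.
have : 0 < q b - q 0.
  rewrite qE mulr_gt0//; move: c'.
  by rewrite /GRing.scale/= pmulr_rgt0 ?invr_gt0.
rewrite subr_gt0 ltNge.
by rewrite (inball b _).2// in_itv/= be.1 andbT (lt_trans _ b0)// oppr_lt0.
Unshelve. all: by end_near. Qed.

(* The mean value theorem in the direction u reduces the second difference of f
   to a first difference of fu. *)
Lemma second_difference {R : realType} {V : normedModType R} (f fu : V -> R)
    (x u v : V) (e : R) :
  0 < e -> (\forall y \near x, is_derive y u f (fu y)) -> differentiable fu x ->
  \forall h \near 0^'+,
    `|f (x + h *: u + h *: v) - f (x + h *: u) - f (x + h *: v) + f x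
      - h ^+ 2 * 'D_v fu x| <= e * h ^+ 2.
Proof.
move=> e0 dfu /[dup] dd /diff_locallyP[cd].
move=> /eqaddoP ddE.
(* [h * C] bounds the norm of [s *: u + t *: v] for [s] and [t] in [[0, h]], and the [+ 1] keeps [C]
   positive. With tolerance [e / (2 * C)], each of the two linearisations of [fu] below is off by at
   most [e / 2 * h]. *)
pose C := `|u| + `|v| + 1.
have C0 : 0 < C by rewrite /C ltr_wpDl// addr_ge0.
have e'0 : 0 < e / (2 * C) by rewrite divr_gt0// mulr_gt0.
have /nbhs_ballP[r /= r0 Hr] := ddE _ e'0.
have /nbhs_ballP[r' /= r'0 Hr'] := dfu.
near=> h.
have h0 : 0 < h by near: h; exact: nbhs_right_gt.
have hr : h * C < r.
  rewrite -ltr_pdivlMr//; near: h; apply: nbhs_right_lt; exact: divr_gt0.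
have hr' : h * C < r'.
  rewrite -ltr_pdivlMr//; near: h; apply: nbhs_right_lt; exact: divr_gt0.
have small s t : 0 <= s <= h -> 0 <= t <= h -> `|s *: u + t *: v| <= h * C.
  move=> /andP[s0 sh] /andP[t0 th]; rewrite (le_trans (ler_normD _ _))//.
  rewrite !normrZ !ger0_norm// /C !mulrDr mulr1 -[leLHS]addr0.
  by rewrite !lerD ?ler_wpM2r// ltW.
have der s t : 0 <= s <= h -> 0 <= t <= h ->
    is_derive (x + t *: v + s *: u) u f (fu (x + t *: v + s *: u)).
  move=> s0 t0; apply: Hr'; rewrite -ball_normE/= -addrA opprD addNKr normrN.
  by rewrite [t *: v + _]addrC (le_lt_trans (small _ _ s0 t0)).
pose F s := f (x + h *: v + s *: u) - f (x + s *: u).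
have hh : 0 <= h <= h by rewrite ltW/=.
have zh : 0 <= (0 : R) <= h by rewrite lexx ltW.
have derF s : 0 <= s <= h -> is_derive s 1 F
    (fu (x + h *: v + s *: u) - fu (x + s *: u)).
  move=> s0; apply: is_deriveB.
    by apply: is_derive_line; exact: der.
  apply: is_derive_line; have := der s 0 s0 zh.
  by rewrite scale0r addr0.
have [| |c] := @MVT R F
   (fun s => fu (x + h *: v + s *: u) - fu (x + s *: u)) 0 h h0.
- move=> s /[!in_itv]/= /andP[s0 sh]; apply: derF; by rewrite !ltW.
- apply: derivable_within_continuous => s /[!in_itv]/= s0.
  by have [] := derF _ s0.
rewrite in_itv/= => /andP[c0 ch].
have cc : 0 <= c <= h by rewrite !ltW.
rewrite subr0 /F scale0r !addr0 => FE.
have -> : f (x + h *: u + h *: v) - f (x + h *: u) - f (x + h *: v) + f x =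
    (fu (x + h *: v + c *: u) - fu (x + c *: u)) * h.
  by rewrite -FE [x + h *: u + _]addrAC; ring.
have bnd t : 0 <= t <= h ->
    `|fu (x + t *: v + c *: u) - fu x - 'd fu x (c *: u + t *: v)|
      <= e / 2 * h.
  move=> t0; have := Hr (c *: u + t *: v).
  rewrite -ball_normE/= sub0r normrN => /(_ (le_lt_trans (small _ _ cc t0) hr)).
  have -> : fu (x + t *: v + c *: u) - fu x
      - 'd fu x (c *: u + t *: v) =
      (fu \o shift x - (cst (fu x) + 'd fu x)) (c *: u + t *: v).
    rewrite -[RHS]/(fu (c *: u + t *: v + x) - (fu x + _)) opprD addrA.
    by congr (fu _ - _ - _); rewrite addrC [x + _]addrC addrA.
  move=> /le_trans; apply.
  rewrite (@le_trans _ _ (e / (2 * C) * (h * C)))//.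
    by rewrite ler_pM2l//; exact: small.
  have : C != 0 by exact: lt0r_neq0.
  by move=> ?; rewrite le_eqVlt; apply/orP; left; apply/eqP; field.
have lin t : 'd fu x (c *: u + t *: v) =
    c * 'd fu x u + t * 'd fu x v by rewrite linearD !linearZ.
have := bnd h hh; have := bnd 0 zh; rewrite !lin scale0r addr0 mul0r addr0.
rewrite (@deriveE _ _ _ _ _ v)//.
set A := fu (x + c *: u); set B := fu (x + h *: v + c *: u).
set D := 'd _ _ v; set E := 'd _ _ u; set G := fu x.
rewrite !ler_norml => /andP[a1 a2] /andP[b1 b2].
have -> : (B - A) * h - h ^+ 2 * D = (B - A - h * D) * h by ring.
have -> : e * h ^+ 2 = (e * h) * h by ring.
rewrite -mulNr !ler_pM2r//.
apply/andP; split; lra.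
Unshelve. all: by end_near. Qed.

(** The second difference of [f] is symmetric in [u] and [v]. Each mixed derivative times [h ^+ 2]
    is within [e / 2 * h ^+ 2] of it, so the two differ by at most [e], for every [e > 0]. *)
Lemma derive_swap {R : realType} {V : normedModType R} (f fu fv : V -> R)
    (x u v : V) :
  (\forall y \near x, is_derive y u f (fu y)) ->
  (\forall y \near x, is_derive y v f (fv y)) ->
  differentiable fu x -> differentiable fv x -> 'D_v fu x = 'D_u fv x.
Proof.
move=> du dv ddu ddv; apply/eqP; rewrite -subr_eq0 -normr_le0.
apply/ler_addgt0Pl => e e0; rewrite addr0.
have e20 : 0 < e / 2 by exact: divr_gt0.
have D1 := second_difference f fu x u v _ e20 du ddu.
have D2 := second_difference f fv x v u _ e20 dv ddv.
have [h [[h1 h2] h0]] := filter_ex (filterI (filterI D1 D2) (nbhs_right_gt (0 : R))).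
move: h1 h2.
have -> : x + h *: v + h *: u = x + h *: u + h *: v by rewrite addrAC.
set A := f (x + h *: u + h *: v); set B := f (x + h *: u).
set D := f (x + h *: v); set E := f x.
set P := 'D_v fu x; set Q := 'D_u fv x => h1 h2.
clearbody A B D E P Q.
have h20 : 0 < h ^+ 2 by exact: exprn_gt0.
rewrite -(ler_pM2r h20) -[h ^+ 2 in leLHS]gtr0_norm// -normrM.
have -> : (P - Q) * h ^+ 2 = (A - D - B + E - h ^+ 2 * Q) -
   (A - B - D + E - h ^+ 2 * P) by ring.
by rewrite (le_trans (ler_normB _ _))// [e in leRHS]splitr mulrDl lerD.
Qed.

(** * Linear algebra *)

Lemma posdef_unitmx {R : realFieldType} {n : nat} (A : 'M[R]_n) :
  (forall v : 'rV_n, v != 0 -> 0 < (v *m A *m v^T) 0 0) -> A \in unitmx.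
Proof.
move=> Apos; rewrite -row_free_unit; apply: inj_row_free => v vA0.
apply/eqP/negPn/negP => /Apos.
by rewrite vA0 mul0mx mxE ltxx.
Qed.

Lemma posdef_invmx {R : realFieldType} {n : nat} (A : 'M[R]_n) :
  A^T = A -> (forall v : 'rV_n, v != 0 -> 0 < (v *m A *m v^T) 0 0) ->
  forall v : 'rV_n, v != 0 -> 0 < (v *m invmx A *m v^T) 0 0.
Proof.
move=> Asym Apos v v0; have Au := posdef_unitmx _ Apos.
have -> : v *m invmx A *m v^T = (v *m invmx A) *m A *m (v *m invmx A)^T.
  by rewrite mulmxKV// trmx_mul trmx_inv Asym mulmxA.
apply: Apos; apply: contra_neq v0 => /(congr1 (mulmx^~ A)).
by rewrite mulmxKV// mul0mx.
Qed.

(** Induction on the size, splitting off the first row and column of [A]. The rank one square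
    contributes a positive multiple of [w *m B *m w^T]; the Schur complement, again positive
    definite, is paired with the lower right block of [B]. *)
Lemma mxtrace_mul_psd {R : realFieldType} {n : nat} (A B : 'M[R]_n) :
  A^T = A -> (forall v : 'rV_n, v != 0 -> 0 < (v *m A *m v^T) 0 0) ->
  (forall v : 'rV_n, 0 <= (v *m B *m v^T) 0 0) -> 0 <= \tr (A *m B).
Proof.
elim: n A B => [|n IHn] A B; first by move=> *; rewrite /mxtrace big_ord0.
rewrite -[n.+1]/(1 + n)%N in A B * => Asym Apos Bpos.
pose a := A 0 0; pose r := ursubmx A.
pose w := row_mx a%:M r.
pose A' := drsubmx A - a^-1 *: (r^T *m r).
have a0 : 0 < a.
  have /Apos : delta_mx 0 0 != 0 :> 'rV[R]_(1 + n).
    by apply/eqP => /matrixP/(_ 0 0); rewrite !mxE eqxx; apply/eqP/oner_neq0.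
  by rewrite -rowE trmx_delta -colE !mxE.
have aN0 : a != 0 by exact: lt0r_neq0.
have ulA : ulsubmx A = a%:M.
  apply/matrixP => i j; rewrite !ord1 !mxE eqxx mulr1n /a.
  by congr (A _ _); apply/val_inj.
have dlA : dlsubmx A = r^T by rewrite /r trmx_ursub Asym.
(* A is a rank one square plus its Schur complement A'. *)
have AE : A = a^-1 *: (w^T *m w) + block_mx 0 0 0 A'.
  rewrite -[LHS]submxK ulA dlA -/r /w tr_row_mx mul_col_row scale_block_mx.
  rewrite add_block_mx !addr0 /A' addrC subrK tr_scalar_mx.
  rewrite -scalar_mxM scale_scalar_mx mulKf// mul_scalar_mx mul_mx_scalar.
  by rewrite !scalerA mulVf// !scale1r.
have A'pos (v : 'rV_n) : v != 0 -> 0 < (v *m A' *m v^T) 0 0.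
  (* The first entry of [z] is chosen so that [z *m w^T = 0]; the value of [A] on [z] is then that
     of [A'] on [v]. *)
  move=> v0; pose z := row_mx (- a^-1 *: (v *m r^T)) v.
  have zw : z *m w^T = 0.
    rewrite /z /w tr_row_mx mul_row_col tr_scalar_mx mul_mx_scalar scalerA.
    by rewrite mulrN mulfV// scaleN1r addNr.
  have := Apos z; rewrite AE mulmxDr mulmxDl -scalemxAr -scalemxAl.
  rewrite mulmxA zw !mul0mx scaler0 add0r /z mul_row_block !mulmx0 !addr0.
  rewrite add0r tr_row_mx mul_row_col mul0mx add0r; apply.
  apply/eqP => /(congr1 rsubmx); rewrite row_mxKr => z0.
  by move: v0; rewrite z0 linear0 eqxx.
have A'sym : A'^T = A'.
  by rewrite /A' linearB linearZ/= trmx_mul trmxK trmx_drsub Asym.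
rewrite AE mulmxDl linearD/= -scalemxAl linearZ/= -mulmxA mxtrace_mulC.
apply: addr_ge0.
  by apply: mulr_ge0; [rewrite invr_ge0 ltW|rewrite /mxtrace big_ord1 Bpos].
rewrite -[B]submxK mulmx_block mxtrace_block !mul0mx !addr0 linear0 !add0r.
apply: IHn => // v; have := Bpos (row_mx 0 v).
by rewrite -[B]submxK mul_row_block tr_row_mx mul_row_col !mul0mx !add0r trmx0
  mulmx0 add0r block_mxKdr.
Qed.

(** * Traces and gradients for the Gibbons-Hawking metric at a point *)

Section gibbons_hawking_matrix.
Context {R : realFieldType} {n q : nat}.
Variables (f : R) (e : 'cV[R]_n) (J : 'M[R]_(n, q)) (xi : 'rV[R]_n).
Hypotheses (f0 : 0 < f) (xie : xi *m e = 1%:M) (xiJ : xi *m J = 0).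
Let h := f^-1 *: (e *m e^T) + f *: (J *m J^T).
Hypothesis hu : h \in unitmx.

Let fN0 : f != 0. Proof. exact: lt0r_neq0. Qed.

Let xih : xi *m h = f^-1 *: e^T.
Proof.
by rewrite mulmxDr -!scalemxAr !mulmxA xie xiJ mul1mx mul0mx scaler0 addr0.
Qed.

(** Since [xi] is [h]-dual to [f^-1 *: e^T], tracing against [invmx h] a product with a factor [e]
    amounts to evaluation on [f *: xi]. The vertical and mixed traces follow from this. *)
Let eh : e^T *m invmx h = f *: xi.
Proof.
by rewrite -[e^T](scalerKV fN0) -xih scalemxAl mulmxK.
Qed.

Lemma gh_trace_vertical : \tr (invmx h *m (e *m e^T)) = f.
Proof.
by rewrite mulmxA mxtrace_mulC mulmxA eh -scalemxAl xie linearZ/= mxtrace1 mulr1.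
Qed.

Lemma gh_trace_mixed (y : 'cV_q) : \tr (invmx h *m (J *m y *m e^T)) = 0.
Proof.
by rewrite mulmxA mxtrace_mulC mulmxA eh -scalemxAl mulmxA xiJ mul0mx scaler0
  linear0.
Qed.

Lemma gh_sym : h^T = h.
Proof. by rewrite linearD !linearZ/= !trmx_mul !trmxK. Qed.

Lemma gh_trace_mixedT (y : 'cV_q) : \tr (invmx h *m (e *m (J *m y)^T)) = 0.
Proof.
rewrite -mxtrace_tr trmx_mul trmx_inv gh_sym trmx_mul trmxK mxtrace_mulC.
exact: gh_trace_mixed.
Qed.

(** The vertical part takes 1 of the total trace [n] of [invmx h *m h]; the horizontal part carries
    the rest. *)
Lemma gh_trace_horizontal : \tr (invmx h *m (J *m J^T)) = f^-1 * (n%:R - 1).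
Proof.
have : \tr (invmx h *m h) = n%:R by rewrite mulVmx// mxtrace1.
rewrite {2}/h mulmxDr -!scalemxAr linearD !linearZ/= gh_trace_vertical mulVf//.
by move=> <-; rewrite [1 + _]addrC addrK mulKf.
Qed.

(** The gradient [G] of a function of the base point is horizontal, so [G *m h = w *m J^T] reduces
    to [f *: (G *m J) *m J^T = w *m J^T], and the full rank of [J] allows [J^T] to be cancelled. *)
Lemma gh_gradient (w : 'rV_q) : \rank J = q ->
  (w *m J^T *m invmx h *m e = 0) /\ (w *m J^T *m invmx h *m J = f^-1 *: w).
Proof.
move=> rJ; set G := w *m J^T *m invmx h.
have Ge : G *m e = 0.
  have GT : G^T = invmx h *m (J *m w^T).
    by rewrite /G trmx_mul trmx_inv gh_sym trmx_mul trmxK.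
  rewrite -[LHS]trmxK trmx_mul GT mulmxA eh -scalemxAl mulmxA xiJ mul0mx.
  by rewrite scaler0 trmx0.
split=> //.
have : G *m h = w *m J^T by rewrite mulmxKV.
rewrite mulmxDr -!scalemxAr mulmxA Ge mul0mx scaler0 add0r mulmxA.
rewrite scalemxAl => GJ.
have Jf : row_free J^T by rewrite /row_free mxrank_tr rJ.
by have <- := row_free_inj Jf GJ; rewrite scalerK.
Qed.

End gibbons_hawking_matrix.

(** A positive definite matrix has rank [n.+1], of which the [e] part accounts for at most 1, so [J]
    has rank [n]. A nonzero vector killed by [J] exists by counting dimensions; positivity forces
    its pairing with [e] to be nonzero, and it is rescaled to make this 1. *)
Lemma gh_vertical {R : realFieldType} {n : nat} (f : R) (e : 'cV[R]_n.+1)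
    (J : 'M[R]_(n.+1, n)) :
  0 < f ->
  (forall v : 'rV_n.+1, v != 0 ->
    0 < (v *m (f^-1 *: (e *m e^T) + f *: (J *m J^T)) *m v^T) 0 0) ->
  \rank J = n /\ exists2 xi : 'rV_n.+1, xi *m e = 1%:M & xi *m J = 0.
Proof.
move=> f0 gpos; pose g := f^-1 *: (e *m e^T) + f *: (J *m J^T).
have gu : g \in unitmx := posdef_unitmx _ gpos; split.
  apply/eqP; rewrite eqn_leq rank_leq_col/=.
  have := mxrank_unit gu; rewrite /g => rg.
  have := mxrank_add (f^-1 *: (e *m e^T)) (f *: (J *m J^T)).
  rewrite rg => /leq_trans/(_ (leq_add _ _)).
  move=> /(_ 1%N (\rank J)); rewrite add1n ltnS; apply.
    by rewrite scalemxAl (leq_trans (mxrankM_maxl _ _))// rank_leq_col.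
  by rewrite scalemxAr mxrankM_maxl.
have : kermx J != 0.
  by rewrite -mxrank_eq0 mxrank_ker subn_eq0 -ltnNge ltnS rank_leq_col.
case/rowV0Pn => v /sub_kermxP vJ v0.
have := gpos v v0; rewrite mulmxDr -!scalemxAr !mulmxA vJ mul0mx scaler0 addr0.
rewrite -scalemxAl -[_ *m e *m _ *m _]mulmxA -trmx_mul [v *m e]mx11_scalar tr_scalar_mx.
rewrite -scalar_mxM scale_scalar_mx mxE mulr1n => ve0.
have veN0 : (v *m e) 0 0 != 0.
  by apply: contraTneq ve0 => ->; rewrite !mulr0 ltxx.
exists (((v *m e) 0 0)^-1 *: v).
  by rewrite -scalemxAl {2}[v *m e]mx11_scalar scale_scalar_mx mulVf.
by rewrite -scalemxAl vJ scaler0.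
Qed.

(** * The potential *)

Definition dot {R : realType} {n : nat} (x y : 'rV[R]_n) : R := (x *m y^T) 0 0.

Lemma dotE {R : realType} {n : nat} (x y : 'rV[R]_n) :
  dot x y = \sum_k x 0 k * y 0 k.
Proof. by rewrite /dot mxE; under eq_bigr do rewrite mxE. Qed.

Lemma dotC {R : realType} {n : nat} (x y : 'rV[R]_n) : dot x y = dot y x.
Proof. by rewrite !dotE; apply: eq_bigr => k _; rewrite mulrC. Qed.

Lemma dotDl {R : realType} {n : nat} (x y z : 'rV[R]_n) :
  dot (x + y) z = dot x z + dot y z.
Proof. by rewrite /dot mulmxDl mxE. Qed.

Lemma dotZl {R : realType} {n : nat} (a : R) (x z : 'rV[R]_n) :
  dot (a *: x) z = a * dot x z.
Proof. by rewrite /dot -scalemxAl mxE. Qed.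

Lemma dotZr {R : realType} {n : nat} (a : R) (x z : 'rV[R]_n) :
  dot x (a *: z) = a * dot x z.
Proof. by rewrite dotC dotZl dotC. Qed.

Lemma dotBr {R : realType} {n : nat} (x y z : 'rV[R]_n) :
  dot x (y - z) = dot x y - dot x z.
Proof. by rewrite dotC dotDl -scaleN1r dotZl mulN1r !(dotC x). Qed.

Lemma enormE {R : realType} {n : nat} (x : 'rV[R]_n) :
  enorm x = Num.sqrt (dot x x).
Proof. by rewrite dotE. Qed.

Lemma dot_ge0 {R : realType} {n : nat} (x : 'rV[R]_n) : 0 <= dot x x.
Proof. by rewrite dotE sumr_ge0// => k _; rewrite -expr2 sqr_ge0. Qed.

Lemma dot_eq0 {R : realType} {n : nat} (x : 'rV[R]_n) : (dot x x == 0) = (x == 0).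
Proof.
apply/eqP/eqP => [|->]; last by rewrite /dot mul0mx mxE.
move/eqP; rewrite dotE psumr_eq0 => [/allP x0|k _]; last by rewrite -expr2 sqr_ge0.
apply/rowP => k; rewrite mxE; apply/eqP.
by have /(_ k) := x0; rewrite mem_index_enum -expr2 sqrf_eq0 => /(_ isT).
Qed.

Lemma dot_gt0 {R : realType} {n : nat} (x : 'rV[R]_n) : (0 < dot x x) = (x != 0).
Proof. by rewrite lt0r dot_eq0 dot_ge0 andbT. Qed.

Lemma sqr_enorm {R : realType} {n : nat} (x : 'rV[R]_n) : enorm x ^+ 2 = dot x x.
Proof. by rewrite enormE sqr_sqrtr// dot_ge0. Qed.

Lemma enorm_ge0 {R : realType} {n : nat} (x : 'rV[R]_n) : 0 <= enorm x.
Proof. exact: sqrtr_ge0. Qed.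

Lemma enorm_gt0 {R : realType} {n : nat} (x : 'rV[R]_n) : (0 < enorm x) = (x != 0).
Proof. by rewrite enormE sqrtr_gt0 dot_gt0. Qed.

Lemma cauchy_schwarz {R : realType} {n : nat} (x y : 'rV[R]_n) :
  dot x y <= enorm x * enorm y.
Proof.
have [->|y0] := eqVneq y 0.
  by rewrite dotC /dot mul0mx mxE mulr_ge0// enorm_ge0.
rewrite enormE enormE -sqrtrM ?dot_ge0//.
apply: (le_trans (ler_norm _)); rewrite -sqrtr_sqr; apply: ler_wsqrtr.
(* This squared length equals [b * (a * b - c ^+ 2)], where [a] and [b] are the squared lengths of
   [x] and [y], and [c] is their product. *)
have := dot_ge0 (dot y y *: x - dot x y *: y).
rewrite dotBr !dotZr !(dotC (_ - _)) !dotBr !dotZr (dotC y x).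
have y1 : 0 < dot y y by rewrite dot_gt0.
set a := dot x x; set b := dot y y in y1 *; set c := dot x y.
have -> : b * (b * a - c * c) - c * (b * c - c * b) = b * (a * b - c ^+ 2) by ring.
by rewrite pmulr_rge0// subr_ge0.
Qed.

Lemma differentiable_dot {R : realType} {V : normedModType R} {n : nat}
    (f g : V -> 'rV[R]_n) (x : V) :
  differentiable f x -> differentiable g x ->
  differentiable (fun y => dot (f y) (g y)) x.
Proof.
move=> df dg.
have -> : (fun y => dot (f y) (g y)) =
    \sum_k ((fun y => f y 0 k) * (fun y => g y 0 k)).
  by apply/funext => y; rewrite dotE fct_sumE.
apply: differentiable_sum => k; apply: differentiableM.
  exact: (differentiable_comp df (differentiable_coord _ _ _)).
exact: (differentiable_comp dg (differentiable_coord _ _ _)).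
Qed.

Lemma derive_coord {R : realType} {V : normedModType R} {m n : nat}
    (f : V -> 'M[R]_(m, n)) (x v : V) i j :
  derivable f x v -> 'D_v (fun y => f y i j) x = ('D_v f x) i j.
Proof. by move=> df; rewrite derive_mx// mxE. Qed.

Lemma is_derive_dot {R : realType} {V : normedModType R} {n : nat}
    (f g : V -> 'rV[R]_n) (x v : V) (df dg : 'rV[R]_n) :
  is_derive x v f df -> is_derive x v g dg ->
  is_derive x v (fun y => dot (f y) (g y)) (dot df (g x) + dot (f x) dg).
Proof.
move=> [df1 dfE] [dg1 dgE].
have -> : (fun y => dot (f y) (g y)) =
    \sum_k ((fun y => f y 0 k) * (fun y => g y 0 k)).
  by apply/funext => y; rewrite dotE fct_sumE.
have -> : dot df (g x) + dot (f x) dg = \sum_k (f x 0 k *: dg 0 k + g x 0 k *: df 0 k).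
  rewrite !dotE -big_split/=; apply: eq_bigr => k _.
  by rewrite addrC [df _ _ * _]mulrC.
apply: is_derive_sum => k; apply: is_deriveM.
  have /derivable_mxP/(_ 0 k) dk := df1.
  by apply: DeriveDef => //; rewrite derive_coord// dfE.
have /derivable_mxP/(_ 0 k) dk := dg1.
by apply: DeriveDef => //; rewrite derive_coord// dgE.
Qed.

Lemma derive_comp {R : realType} {U V W : normedModType R} (f : U -> V)
    (g : V -> W) (x v : U) :
  differentiable f x -> differentiable g (f x) ->
  'D_v (g \o f) x = 'D_('D_v f x) g (f x).
Proof.
move=> df dg; rewrite deriveE; last exact: differentiable_comp.
by rewrite diff_comp//= !deriveE.
Qed.

Lemma deriveZv {R : realType} {V W : normedModType R} (f : V -> W) (x v : V) (a : R) :
  differentiable f x -> 'D_(a *: v) f x = a *: 'D_v f x.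
Proof. by move=> df; rewrite !deriveE// linearZ. Qed.

Lemma derive_half_inv_sqrt {R : realType} (s : R) : 0 < s ->
  is_derive s 1 (fun t => (2 * Num.sqrt t)^-1) (- (4 * (s * Num.sqrt s))^-1).
Proof.
move=> s0; have r0 : 0 < Num.sqrt s by rewrite sqrtr_gt0.
have d1 : is_derive s 1 (fun t => 2 * Num.sqrt t) (2 * (2 * Num.sqrt s)^-1).
  have := is_derive1_sqrt s0; exact: is_deriveZ.
have sN0 : 2 * Num.sqrt s != 0 by rewrite mulf_neq0// lt0r_neq0.
have [d1d d1E] := d1.
apply: DeriveDef; first exact: derivableV.
rewrite deriveV// d1E /GRing.scale/=.
have rN0 : Num.sqrt s != 0 by exact: lt0r_neq0.
move: rN0 (sqr_sqrtr (ltW s0)); set q := Num.sqrt s => rN0 <-.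
by field.
Qed.

Lemma pole_derive {R : realType} {n : nat} (p x v : 'rV[R]_n) : x != p ->
  differentiable (fun y => (2 * enorm (y - p))^-1) x /\
  'D_v (fun y => (2 * enorm (y - p))^-1) x =
    - (dot v (x - p) / (2 * enorm (x - p) ^+ 3)).
Proof.
move=> xp; pose r y := dot (y - p) (y - p).
have r0 : 0 < r x by rewrite dot_gt0 subr_eq0.
have dl : differentiable (fun y : 'rV[R]_n => y - p) x by exact: differentiableB.
have dr : differentiable r x by exact: differentiable_dot.
have -> : (fun y => (2 * enorm (y - p))^-1) = (fun t => (2 * Num.sqrt t)^-1) \o r.
  by apply/funext => y; rewrite /= enormE.
have [dh hE] := derive_half_inv_sqrt (r x) r0.
have dh' : differentiable (fun t => (2 * Num.sqrt t)^-1) (r x).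
  exact/derivable1_diffP.
split; first exact: differentiable_comp.
rewrite derive_comp// -[X in 'D_X _ (r x)]mulr1 deriveZv// hE.
have il : is_derive x v (fun y : 'rV[R]_n => y - p) v.
  rewrite -[X in is_derive _ _ _ X]subr0; exact: is_deriveB.
have [_ ->] := is_derive_dot _ _ _ _ _ _ il il.
rewrite /GRing.scale/= enormE -/(r x) (dotC (x - p)).
have sN0 : Num.sqrt (r x) != 0 by rewrite lt0r_neq0// sqrtr_gt0.
move: sN0 (sqr_sqrtr (ltW r0)); set q := Num.sqrt (r x) => sN0 <-.
by field.
Qed.

Section potential.
Context {R : realType} {k : nat}.
Variables (p : 'I_k -> 'rV[R]_3) (m : R) (x : 'rV[R]_3).
Hypothesis xp : ~ range p x.

Let xpi i : x != p i.
Proof. by apply/eqP => xE; apply: xp; exists i. Qed.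

Let potE : gh_potential p m =
  cst m + \sum_i (fun y => (2 * enorm (y - p i))^-1).
Proof. by apply/funext => y; rewrite /gh_potential !fctE fct_sumE. Qed.

Lemma gh_potential_diff : differentiable (gh_potential p m) x.
Proof.
rewrite potE; apply: differentiableD => //; apply: differentiable_sum => i.
by have [] := pole_derive (p i) x 0 (xpi i).
Qed.

Lemma gh_potential_derive v : 'D_v (gh_potential p m) x =
  - \sum_i dot v (x - p i) / (2 * enorm (x - p i) ^+ 3).
Proof.
have dp i := pole_derive (p i) x v (xpi i).
have dpi i : derivable (fun y => (2 * enorm (y - p i))^-1) x v.
  by apply: diff_derivable; have [] := dp i.
rewrite potE deriveD//; last exact: derivable_sum.
rewrite derive_cst add0r derive_sum// -sumrN.
by apply: eq_bigr => i _; have [_ ->] := dp i.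
Qed.

Let xpi0 i : 0 < enorm (x - p i).
Proof. by rewrite enorm_gt0 subr_eq0. Qed.

Lemma gh_potential_gt0 : (0 < k)%N -> 0 <= m -> 0 < gh_potential p m x.
Proof.
move=> k0 m0; rewrite /gh_potential ltr_wpDl//.
case: k p xpi0 k0 => // k' p' r0 _; rewrite big_ord_recl/= ltr_pwDl//.
  by rewrite invr_gt0 mulr_gt0.
by rewrite sumr_ge0// => i _; rewrite invr_ge0 mulr_ge0// ltW.
Qed.

(** The derivative of the potential along [x] itself splits over the poles. Each pole contributes a
    positive term, and the constant contributes [4 * m >= 0]. *)
Lemma gh_potential_convex : (0 < k)%N -> 0 <= m ->
  (forall i, enorm x < enorm (p i) \/ 4 / 3 * enorm (p i) < enorm x) ->
  0 < 4 * gh_potential p m x + 'D_x (gh_potential p m) x.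
Proof.
move=> k0 m0 xP; rewrite gh_potential_derive /gh_potential mulrDr -addrA.
rewrite ltr_wpDl ?mulr_ge0// mulr_sumr -sumrB.
have pos i : 0 < 4 * (2 * enorm (x - p i))^-1 -
    dot x (x - p i) / (2 * enorm (x - p i) ^+ 3).
  have r0 := xpi0 i; have rN0 := lt0r_neq0 r0.
  have -> : 4 * (2 * enorm (x - p i))^-1 -
      dot x (x - p i) / (2 * enorm (x - p i) ^+ 3) =
    (4 * enorm (x - p i) ^+ 2 - dot x (x - p i)) / (2 * enorm (x - p i) ^+ 3).
    by field.
  rewrite divr_gt0 ?mulr_gt0 ?exprn_gt0// sqr_enorm dotBr (dotC (_ - _)) dotBr.
  rewrite (dotC (_ - _)) dotBr -!sqr_enorm (dotC (p i)).
  have := cauchy_schwarz x (p i); have := enorm_ge0 x; have := enorm_ge0 (p i).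
  move: (xP i); set X := enorm x; set P := enorm (p i); set c := dot x (p i).
  move=> XP P0 X0 cXP.
  (* Both factors are negative when [X < P] and positive when [4 / 3 * P < X]. The numerator
     [3 * X ^+ 2 - 7 * c + 4 * P ^+ 2] is at least this product because [c <= X * P]. *)
  have : 0 < (3 * X - 4 * P) * (X - P).
    case: XP => XP; last by apply: mulr_gt0; lra.
    by rewrite -mulrNN; apply: mulr_gt0; lra.
  nra.
case: k p pos k0 => // k' p' pos _; rewrite big_ord_recl/= ltr_pwDl//.
by rewrite sumr_ge0// => i _; rewrite ltW.
Qed.
End potential.

(** * The Koszul formula *)

Lemma derive_basis {R : realType} {n : nat} {W : normedModType R}
    (f : 'rV[R]_n -> W) (y v : 'rV[R]_n) : differentiable f y ->
  'D_v f y = \sum_i v 0 i *: 'D_(delta_mx 0 i) f y.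
Proof.
move=> df; rewrite deriveE// {1}[v]row_sum_delta linear_sum.
by apply: eq_bigr => i _; rewrite linearZ/= deriveE.
Qed.

Lemma is_derive_mx {R : realType} {V : normedModType R} {m n : nat}
    (f : V -> 'M[R]_(m, n)) (y v : V) (df : 'M[R]_(m, n)) :
  (forall i j, is_derive y v (fun z => f z i j) (df i j)) -> is_derive y v f df.
Proof.
move=> dfij; have dfd : derivable f y v.
  by apply/derivable_mxP => i j; have [] := dfij i j.
apply: DeriveDef => //; apply/matrixP => i j.
by rewrite -derive_coord//; have [] := dfij i j.
Qed.

Lemma is_derive_coord {R : realType} {V : normedModType R} {m n : nat}
    (f : V -> 'M[R]_(m, n)) (y v : V) (df : 'M[R]_(m, n)) i j :
  is_derive y v f df -> is_derive y v (fun z => f z i j) (df i j).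
Proof.
move=> [dfd <-]; have /derivable_mxP/(_ i j) dfij := dfd.
by apply: DeriveDef => //; rewrite derive_coord.
Qed.

Lemma is_derive_mulmxl {R : realType} {V : normedModType R} {m n q : nat}
    (A : 'M[R]_(m, n)) (f : V -> 'M[R]_(n, q)) (y v : V) (df : 'M[R]_(n, q)) :
  is_derive y v f df -> is_derive y v (fun z => A *m f z) (A *m df).
Proof.
move=> dfd; apply: is_derive_mx => i j; rewrite mxE.
have -> : (fun z => (A *m f z) i j) = \sum_k (fun z => A i k *: f z k j).
  by apply/funext => z; rewrite mxE fct_sumE.
apply: is_derive_sum => k; apply: (@is_deriveZ _ _ _ (fun z => f z k j)).
exact: is_derive_coord.
Qed.

Lemma is_derive_trmx {R : realType} {V : normedModType R} {m n : nat}
    (f : V -> 'M[R]_(m, n)) (y v : V) (df : 'M[R]_(m, n)) :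
  is_derive y v f df -> is_derive y v (fun z => (f z)^T) df^T.
Proof.
move=> dfd; apply: is_derive_mx => i j; rewrite mxE.
have -> : (fun z => (f z)^T i j) = (fun z => f z j i).
  by apply/funext => z; rewrite mxE.
exact: is_derive_coord.
Qed.

Lemma is_derive_mulmxr {R : realType} {V : normedModType R} {m n q : nat}
    (A : 'M[R]_(n, q)) (f : V -> 'M[R]_(m, n)) (y v : V) (df : 'M[R]_(m, n)) :
  is_derive y v f df -> is_derive y v (fun z => f z *m A) (df *m A).
Proof.
move=> /is_derive_trmx/(is_derive_mulmxl A^T)/is_derive_trmx.
rewrite trmx_mul !trmxK.
have -> // : (fun z => (A^T *m (f z)^T)^T) = (fun z => f z *m A).
by apply/funext => z; rewrite trmx_mul !trmxK.
Qed.

Lemma derive_mx_swap {R : realType} {V : normedModType R} {m n : nat}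
    (f : V -> 'M[R]_(m, n)) (x u v : V) :
  (\forall y \near x, differentiable f y) ->
  differentiable ('D_u f) x -> differentiable ('D_v f) x ->
  'D_v ('D_u f) x = 'D_u ('D_v f) x.
Proof.
move=> df du dv; apply/matrixP => i j.
have L (h : V -> 'M[R]_(m, n)) w : differentiable h x ->
    ('D_w h x) i j = 'D_w (fun z => h z i j) x.
  by move=> dh; rewrite derive_coord//; exact: diff_derivable.
apply: etrans (L _ v du) (etrans _ (esym (L _ u dv))).
have E w : \forall y \near x, is_derive y w (fun z => f z i j) ('D_w f y i j).
  near=> y; have dfy : derivable f y w by apply: diff_derivable; near: y.
  have /derivable_mxP/(_ i j) dfij := dfy.
  by apply: DeriveDef => //; rewrite derive_coord.
apply: derive_swap (E u) (E v) _ _.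
  exact: (differentiable_comp du (differentiable_coord _ _ _)).
exact: (differentiable_comp dv (differentiable_coord _ _ _)).
Unshelve. all: by end_near. Qed.

Section koszul.
Context {R : realType} {n : nat} {X : manifold R n}.
Variables (g : riemannian_metric X) (c : chart R n X) (x : X).
Hypotheses (ca : atlas c) (cx : cdom c x).
Let y0 := cmap c x.
Let G (a b y : 'rV[R]_n) : R := (a *m gmat g c (cinv c y) *m b^T) 0 0.

Let gdiff : differentiable (gmat g c \o cinv c) y0.
Proof. by apply: (gmat_smooth g ca [::]); exists x. Qed.

Let DG (v a b : 'rV[R]_n) : 'D_v (G a b) y0 =
  (a *m 'D_v (gmat g c \o cinv c) y0 *m b^T) 0 0.
Proof.
apply: derive_val; apply: (is_derive_coord (fun z => a *m gmat g c (cinv c z) *m b^T)).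
apply: is_derive_mulmxr; apply: (is_derive_mulmxl a (gmat g c \o cinv c)).
exact/derivableP/diff_derivable.
Qed.

(** Lowering the index cancels the inverse metric in the Christoffel symbols. The coordinate fields
    and [Z] are constant in the chart, so no Lie brackets appear. *)
Lemma koszul (i j : 'I_n) (Z : 'rV[R]_n) :
  ((\row_a christoffel g c x i j a) *m gmat g c x *m Z^T) 0 0 =
  2^-1 * ('D_(delta_mx 0 i) (G (delta_mx 0 j) Z) y0
          + 'D_(delta_mx 0 j) (G (delta_mx 0 i) Z) y0
          - 'D_Z (G (delta_mx 0 i) (delta_mx 0 j)) y0).
Proof.
have gpos := fun v : 'rV[R]_n => @gmat_pos _ _ _ g c x v ca cx.
have gsym := gmat_sym g ca cx.
have gu : gmat g c x \in unitmx by exact: posdef_unitmx.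
pose dg l i' j' := 'D_(delta_mx 0 l) (gmat g c \o cinv c) y0 i' j'.
have GE l i' j' : pderiv l (fun y => gmat g c (cinv c y) i' j') y0 = dg l i' j'.
  by apply: derive_coord; exact: diff_derivable.
pose C := \row_l (dg i j l + dg j i l - dg l i j).
have -> : \row_a christoffel g c x i j a = 2^-1 *: (C *m invmx (gmat g c x)).
  apply/rowP => a; rewrite !mxE /christoffel; congr (_ * _).
  apply: eq_bigr => l _; rewrite !GE mxE mulrC; congr (_ * _).
  by rewrite -{1}gsym -trmx_inv mxE.
rewrite -!scalemxAl mulmxKV// mxE; congr (_ * _).
rewrite !DG [in X in _ - X](derive_basis (gmat g c \o cinv c))//.
rewrite mxE; under eq_bigr do rewrite !mxE mulrBl mulrDl.
rewrite big_split/= big_split/= sumrN; congr (_ + _ - _).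
- by rewrite -mulmxA -rowE !mxE; apply: eq_bigr => l _; rewrite !mxE.
- by rewrite -mulmxA -rowE !mxE; apply: eq_bigr => l _; rewrite !mxE.
- rewrite mulmx_sumr mulmx_suml summxE; apply: eq_bigr => l _.
  rewrite -scalemxAr -scalemxAl -rowE trmx_delta -colE !mxE mulrC.
  by [].
Qed.
End koszul.

(** The Leibniz expansion of the derivative of [f^-1 * (nb * nc) + f * dot Jb Jc], where [df], [eb],
    [ec], [Kb], [Kc] are the derivatives of [f], [nb], [nc], [Jb], [Jc]. *)
Definition metricD {R : realType} {q : nat} (f df nb nc eb ec : R)
    (Jb Jc Kb Kc : 'rV[R]_q) : R :=
  - f ^- 2 * df * (nb * nc) + f^-1 * (eb * nc + nb * ec)
  + df * dot Jb Jc + f * (dot Kb Jc + dot Jb Kc).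

(** The direction [Z] is horizontal over [f^-1 *: w], while [a] and [b] project orthogonally to [w];
    this removes the terms in [fa] and [fb]. Symmetry of the second derivatives [K] cancels all of
    them except [Kab]. *)
Lemma koszul_algebra {R : realType} {q : nat} (f fa fb fZ s na nb nZ : R)
    (EaZ EZa EbZ EZb Eab Eba : R) (Ja Jb JZ w KaZ KZa KbZ KZb Kab Kba : 'rV[R]_q) :
  f != 0 -> nZ = 0 -> JZ = f^-1 *: w -> KZa = KaZ -> KZb = KbZ -> Kba = Kab ->
  fZ = f^-1 * s -> dot Ja w = 0 -> dot Jb w = 0 ->
  metricD f fa nb nZ Eab EaZ Jb JZ Kab KaZ + metricD f fb na nZ Eba EbZ Ja JZ Kba KbZ
    - metricD f fZ na nb EZa EZb Ja Jb KZa KZb =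
  f^-1 * (nb * (EaZ - EZa) + na * (EbZ - EZb)) + 2 * dot Kab w
  + f ^- 3 * s * (na * nb) - f^-1 * s * dot Ja Jb.
Proof.
move=> f0 -> -> -> -> -> -> aw bw; rewrite /metricD !dotZr aw bw.
rewrite (dotC Jb KaZ) (dotC Ja KbZ).
by move: (dot _ _) (dot _ _) (dot _ _) (dot _ _) => *; field.
Qed.

(* Otherwise failed unification of two derivatives unfolds them to limits. *)
#[local] Opaque derive.

(** * The Koszul formula for the Gibbons-Hawking metric *)

Section metric_derivative.
Context {R : realType} {n q : nat}.
Variables (U : 'rV[R]_n -> 'rV[R]_q) (N : 'rV[R]_n -> 'cV[R]_n).
Variables (phi : 'rV[R]_q -> R) (y : 'rV[R]_n).
Hypotheses (dU : \forall z \near y, differentiable U z).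
Hypotheses (ddU : forall b : 'rV[R]_n, differentiable ('D_b U) y).
Hypotheses (dN : differentiable N y) (dphi : differentiable phi (U y)).
Hypotheses (phi0 : phi (U y) != 0).
Let tN (b z : 'rV[R]_n) : R := (b *m N z) 0 0.
Let G (b c z : 'rV[R]_n) : R := (phi (U z))^-1 * (tN b z * tN c z)
               + phi (U z) * dot ('D_b U z) ('D_c U z).
Let E (a b : 'rV[R]_n) : R := (b *m 'D_a N y) 0 0.
Let K (a b : 'rV[R]_n) := 'D_a ('D_b U) y.
Let f := phi (U y).

Let M (a b c : 'rV[R]_n) : R :=
  metricD f ('D_('D_a U y) phi (U y)) (tN b y) (tN c y) (E a b) (E a c)
    ('D_b U y) ('D_c U y) (K a b) (K a c).

Let metric_derive a b c : is_derive y a (G b c) (M a b c).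
Proof.
rewrite /M /metricD.
have dUy : differentiable U y := nbhs_singleton dU.
have dpU : is_derive y a (phi \o U) ('D_('D_a U y) phi (U y)).
  rewrite -derive_comp//; apply/derivableP/diff_derivable.
  exact: differentiable_comp.
have dtN b' : is_derive y a (tN b') (E a b').
  apply: is_derive_coord; apply: is_derive_mulmxl.
  exact/derivableP/diff_derivable.
have dK b' : is_derive y a ('D_b' U) (K a b').
  exact/derivableP/diff_derivable.
have [dpd dpE] := dpU.
have dpV : is_derive y a (fun z => (phi (U z))^-1)
    (- f ^- 2 * 'D_('D_a U y) phi (U y)).
  apply: DeriveDef; first exact: (derivableV _ dpd).
  by apply: etrans (deriveV (f := phi \o U) phi0 dpd) _; rewrite dpE.
have d1 := is_deriveM dpV (is_deriveM (dtN b) (dtN c)).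
have d2 := is_deriveM dpU (is_derive_dot _ _ _ _ _ _ (dK b) (dK c)).
have := is_deriveD d1 d2.
move: (E a b) (E a c) ('D_('D_a U y) phi (U y)) => Eb Ec dp D; apply: is_derive_eq D _.
rewrite -[LHS]/(f^-1 * (tN b y * Ec + tN c y * Eb) + tN b y * tN c y * (- f ^- 2 * dp)
  + (f * (dot (K a b) ('D_c U y) + dot ('D_b U y) (K a c))
     + dot ('D_b U y) ('D_c U y) * dp)).
by move: (dot _ _) (dot _ _) (dot _ _) (tN b y) (tN c y) f => *; ring.
Qed.

(** Second derivatives [K] of the projection commute, whereas the derivatives [E] of the connection
    form enter through their antisymmetric part. That part is the curvature, left here to be
    evaluated later. *)
Lemma koszul_gibbons_hawking (a b Z : 'rV[R]_n) (w : 'rV[R]_q) :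
  tN Z y = 0 -> 'D_Z U y = f^-1 *: w ->
  dot ('D_a U y) w = 0 -> dot ('D_b U y) w = 0 ->
  'D_a (G b Z) y + 'D_b (G a Z) y - 'D_Z (G a b) y =
  f^-1 * (tN b y * (E a Z - E Z a) + tN a y * (E b Z - E Z b))
  + 2 * dot (K a b) w
  + f ^- 3 * 'D_w phi (U y) * (tN a y * tN b y)
  - f^-1 * 'D_w phi (U y) * dot ('D_a U y) ('D_b U y).
Proof.
move=> NZ UZ aw bw.
have sw u v : K u v = K v u by apply: derive_mx_swap.
have fZ : 'D_('D_Z U y) phi (U y) = f^-1 * 'D_w phi (U y) by rewrite UZ deriveZv.
have H d1 d2 d3 : d1 = M a b Z -> d2 = M b a Z -> d3 = M Z a b -> d1 + d2 - d3 =
    M a b Z + M b a Z - M Z a b by move=> -> -> ->.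
have [_ E1] := metric_derive a b Z; have [_ E2] := metric_derive b a Z.
have [_ E3] := metric_derive Z a b.
apply: etrans (H _ _ _ E1 E2 E3) _.
have := koszul_algebra f ('D_('D_a U y) phi (U y)) ('D_('D_b U y) phi (U y)) _ _
  (tN a y) (tN b y) _ (E a Z) (E Z a) (E b Z) (E Z b) (E a b) (E b a)
  _ _ _ _ _ _ _ _ _ _ phi0 NZ UZ (sw Z a) (sw Z b) (sw b a) fZ aw bw.
exact.
Qed.
End metric_derivative.

Lemma gh_form {R : realType} {n q : nat} (f : R) (N : 'cV[R]_n)
    (J : 'M[R]_(n, q)) (b c : 'rV[R]_n) :
  (b *m (f^-1 *: (N *m N^T) + f *: (J *m J^T)) *m c^T) 0 0 =
  f^-1 * ((b *m N) 0 0 * (c *m N) 0 0) + f * dot (b *m J) (c *m J).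
Proof.
have E q' (A : 'M[R]_(n, q')) : b *m (A *m A^T) *m c^T = b *m A *m (c *m A)^T.
  by rewrite trmx_mul !mulmxA.
rewrite mulmxDr mulmxDl -!scalemxAr -!scalemxAl !E mxE [X in X + _]mxE.
rewrite [X in _ + X]mxE; congr (_ * _ + _).
by rewrite mxE big_ord1 [_^T _ _]mxE.
Qed.

Lemma derive_mulmx {R : realType} {m n : nat} {W : normedModType R}
    (f : 'rV[R]_n -> W) (y : 'rV[R]_n) (a : 'rV[R]_m) (A : 'M[R]_(m, n)) :
  differentiable f y -> 'D_(a *m A) f y = \sum_i a 0 i *: 'D_(row i A) f y.
Proof.
move=> df; rewrite deriveE// mulmx_sum_row linear_sum.
by apply: eq_bigr => i _; rewrite linearZ/= deriveE.
Qed.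

(** This turns the second-order conditions at a maximum, one for each tangent direction, into the
    semidefiniteness of a single matrix. *)
Lemma derive2_mulmx {R : realType} {m n : nat} {W : normedModType R}
    (f : 'rV[R]_n -> W) (y : 'rV[R]_n) (a : 'rV[R]_m) (A : 'M[R]_(m, n)) :
  (\forall z \near y, differentiable f z) ->
  (forall b, differentiable ('D_b f) y) ->
  'D_(a *m A) ('D_(a *m A) f) y =
  \sum_i \sum_j (a 0 i * a 0 j) *: 'D_(row i A) ('D_(row j A) f) y.
Proof.
move=> df ddf; rewrite derive_mulmx//; apply: eq_bigr => i _.
have E : \forall z \near y, 'D_(a *m A) f z =
    (\sum_j a 0 j *: 'D_(row j A) f) z.
  by near=> z; rewrite derive_mulmx ?fct_sumE//; near: z.
rewrite (near_eq_derive _ E) derive_sum; last first.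
  by move=> j; apply/derivableZ/diff_derivable.
rewrite scaler_sumr; apply: eq_bigr => j _.
by rewrite deriveZ ?scalerA//; exact: diff_derivable.
Unshelve. all: by end_near. Qed.

Lemma line_cvg {R : realType} {V : normedModType R} (a v : V) :
  (fun t : R => a + t *: v) @ (0 : R) --> a.
Proof.
rewrite -[X in _ --> X]addr0 -(scale0r v).
apply: cvgD; first exact: cvg_cst.
by apply: cvgZr_tmp; exact: cvg_id.
Qed.

(** The one-variable conditions are applied to [q1 t], the squared length of [U] along the line. The
    two expressions are half of its first and second derivatives at 0. *)
Lemma sqr_norm_at_max {R : realType} {V : normedModType R} {q : nat}
    (U : V -> 'rV[R]_q) (y v : V) :
  (\forall z \near y, differentiable U z) -> differentiable ('D_v U) y ->
  (\forall t \near (0 : R),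
     dot (U (y + t *: v)) (U (y + t *: v)) <= dot (U y) (U y)) ->
  dot ('D_v U y) (U y) = 0 /\
  dot ('D_v ('D_v U) y) (U y) + dot ('D_v U y) ('D_v U y) <= 0.
Proof.
move=> dU ddU Umax.
pose L (t : R) := y + t *: v.
have L0 : L 0 = y by rewrite /L scale0r addr0.
have dUL : \forall t \near (0 : R), differentiable U (L t) by exact: line_cvg dU.
pose q1 t := dot (U (L t)) (U (L t)).
pose dq t := dot ('D_v U (L t)) (U (L t)) *+ 2.
have dq1 : \forall t \near (0 : R), is_derive (t : R) (1 : R) q1 (dq t).
  near=> t.
  have d1 : is_derive t (1 : R) (U \o L) ('D_v U (L t)).
    apply: is_derive_line; apply/derivableP/diff_derivable.
    by near: t.
  by rewrite /dq mulr2n {2}dotC; exact: is_derive_dot.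
have q1' : \forall t \near (0 : R), derive1 q1 t = dq t.
  by near=> t; rewrite derive1E; apply: derive_val; near: t.
have d0 : is_derive (0 : R) (1 : R) (U \o L) ('D_v U y).
  apply: is_derive_line; rewrite scale0r addr0.
  exact/derivableP/diff_derivable/(nbhs_singleton dU).
have d1 : is_derive (0 : R) (1 : R) ('D_v U \o L) ('D_v ('D_v U) y).
  apply: is_derive_line; rewrite scale0r addr0.
  exact/derivableP/diff_derivable.
have ddq : is_derive (0 : R) (1 : R) dq
   ((dot ('D_v ('D_v U) y) (U y) + dot ('D_v U y) ('D_v U y)) *+ 2).
  have := is_derive_dot _ _ _ _ _ _ d1 d0; rewrite /= L0 => d2.
  rewrite mulr2n; have := is_deriveD d2 d2.
  by have -> : dq = (fun t => dot (('D_v U \o L) t) ((U \o L) t)) +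
     (fun t => dot (('D_v U \o L) t) ((U \o L) t)).
have ddq1 : is_derive (0 : R) (1 : R) (derive1 q1)
   ((dot ('D_v ('D_v U) y) (U y) + dot ('D_v U y) ('D_v U y)) *+ 2).
  apply: near_eq_is_derive ddq.
  by near=> t; rewrite -(near q1' t).
have [] := second_derivative_at_max q1.
- by near=> t; have [] := near dq1 t.
- by have [] := ddq1.
- by near=> t; rewrite /q1 L0; near: t.
rewrite (nbhs_singleton q1') /dq L0 => /eqP; rewrite mulrn_eq0/= => /eqP ->.
by rewrite derive1E derive_val pmulrn_lle0.
Unshelve. all: by end_near. Qed.

(** With [A i j] the derivative of the [j]-th component along the [i]-th coordinate, the exterior
    derivative is [A - A^T], and [a *m A] is the derivative along [a]. *)
Lemma ext_deriv_form {R : realType} {n : nat} {X : manifold R n}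
    (eta : chart R n X -> X -> 'cV[R]_n) (c : chart R n X) (x : X)
    (a b : 'rV[R]_n) :
  differentiable (eta c \o cinv c) (cmap c x) ->
  (b *m 'D_a (eta c \o cinv c) (cmap c x)) 0 0
    - (a *m 'D_b (eta c \o cinv c) (cmap c x)) 0 0 =
  (a *m ext_deriv eta c x *m b^T) 0 0.
Proof.
set N := eta c \o cinv c; set y := cmap c x => dN.
pose A := \matrix_(i < n, j < n) ('D_(delta_mx 0 i) N y) j 0.
have -> : ext_deriv eta c x = A - A^T.
  apply/matrixP => i j; rewrite !mxE /pderiv.
  by congr (_ - _); apply: (derive_coord N); exact: diff_derivable.
have E v : v *m A = ('D_v N y)^T.
  apply/rowP => j; rewrite derive_basis// !mxE summxE.
  by apply: eq_bigr => i _; rewrite !mxE.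
have Ea : (a *m A *m b^T) 0 0 = (b *m 'D_a N y) 0 0.
  by rewrite E -trmx_mul [LHS]mxE.
have Eb : a *m A^T *m b^T = a *m 'D_b N y.
  rewrite -mulmxA -trmx_mul E trmxK; exact: erefl.
by rewrite mulmxBr mulmxBl [RHS]mxE [X in _ = _ + X]mxE Ea Eb.
Qed.

(** * The Gibbons-Hawking structure in a chart, away from the poles *)

Section gibbons_hawking_chart.
Context {R : realType} {k : nat} {p : 'I_k -> 'rV[R]_3} {m : R}.
Context {X : manifold R 4} {g : riemannian_metric X} {proj : X -> 'rV[R]_3}.
Context {act : R -> X -> X} {eta : chart R 4 X -> X -> 'cV[R]_4}.
Hypothesis GH : gibbons_hawking p m g proj act eta.
Variable c : chart R 4 X.
Hypothesis ca : atlas c.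
Let D := cmap c @` (cdom c `&` proj @^-1` (~` range p)).
Let U := proj \o cinv c.
Let N := eta c \o cinv c.

Lemma cinv_continuous x : cdom c x -> {for cmap c x, continuous (cinv c)}.
Proof.
move=> cx; have := cinv_cont (c := c).
rewrite continuous_open_subspace; last exact: cimg_open.
by apply; rewrite inE; exists x.
Qed.

Lemma regular_near x : cdom c x -> ~ range p (proj x) ->
  \forall z \near cmap c x, D z.
Proof.
move=> cx xp.
have cU : {for cmap c x, continuous U}.
  apply: continuous_comp; first exact: cinv_continuous.
  exact: (gh_proj_cont GH).
have oP : open (~` range p).
  have /accessible_finite_set_closed cl : accessible_space 'rV[R]_3.
    exact/hausdorff_accessible/norm_hausdorff.
  have fp : finite_set (range p) by apply: finite_image; exact: finite_finset.
  by apply: closed_openC; exact: cl.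
have : \forall z \near cmap c x, (~` range p) (U z).
  apply: cU; apply: open_nbhs_nbhs; split=> //.
  by rewrite /U /= cmapK.
have : \forall z \near cmap c x, (cmap c @` cdom c) z.
  by apply: open_nbhs_nbhs; split; [exact: cimg_open|exists x].
apply: filterS2 => z [x' cx' <-]; rewrite /U /= cmapK// => px'.
by exists x'.
Qed.

Lemma regular_diff z : D z -> [/\ differentiable U z,
  forall b, differentiable ('D_b U) z & differentiable N z].
Proof.
move=> Dz; have [/(_ c ca) sU _] := gh_bundle GH.
have [_ /(_ c ca) sN] := conn_form (gh_connection GH).
split; first exact: (sU [::]).
  by move=> b; exact: (sU [:: b]).
exact: (sN [::]).
Qed.

Lemma regular_metric z : D z -> gmat g c (cinv c z) =
  (gh_potential p m (U z))^-1 *: (N z *m (N z)^T)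
  + gh_potential p m (U z) *: ('J U z *m ('J U z)^T).
Proof.
move=> [x [cx px] <-]; have := gh_metric GH ca cx px.
by rewrite /U /N /chart_jac /= cmapK.
Qed.

End gibbons_hawking_chart.

(** The trace of [B] against [invmx h] is nonpositive. In it [M] and the mixed terms, which carry
    the curvature vector [z], vanish. The horizontal trace is [2 / f], as the matrices live on a
    3-dimensional tangent space, and the total is [(4 * f + s) / (2 * f ^+ 2)]. *)
Lemma gh_trace_contradiction {R : realFieldType} {q : nat} (f s : R)
    (e : 'cV[R]_3) (J : 'M[R]_(3, q)) (xi : 'rV[R]_3) (z : 'cV[R]_q)
    (h M B : 'M[R]_3) :
  0 < f -> xi *m e = 1%:M -> xi *m J = 0 ->
  h = f^-1 *: (e *m e^T) + f *: (J *m J^T) ->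
  (forall v : 'rV_3, v != 0 -> 0 < (v *m h *m v^T) 0 0) ->
  B = M + (1 + s / (2 * f)) *: (J *m J^T) - (s / 2 * f ^- 3) *: (e *m e^T)
      - (f ^- 2 / 2) *: (e *m (J *m z)^T + J *m z *m e^T) ->
  \tr (invmx h *m M) = 0 -> (forall a : 'rV_3, (a *m B *m a^T) 0 0 <= 0) ->
  ~ 0 < 4 * f + s.
Proof.
move=> f0 xie xiJ hE hpos BE trM Bneg fs.
have hu := posdef_unitmx _ hpos.
have hsym : h^T = h by rewrite hE gh_sym.
have := mxtrace_mul_psd (invmx h) (- B).
rewrite trmx_inv hsym => /(_ erefl (posdef_invmx _ hsym hpos)).
have Bpos (v : 'rV_3) : 0 <= (v *m - B *m v^T) 0 0.
  by rewrite mulmxN mulNmx mxE oppr_ge0.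
move=> /(_ Bpos); apply/negP; rewrite -ltNge.
rewrite mulmxN raddfN/= oppr_lt0 BE !mulmxBr mulmxDr -!scalemxAr mulmxDr.
rewrite !raddfB/= mxtraceD !mxtraceZ mxtraceD trM hE in hu *.
rewrite (gh_trace_vertical _ _ _ _ f0 xie xiJ hu).
rewrite (gh_trace_mixed _ _ _ _ f0 xie xiJ hu).
rewrite (gh_trace_mixedT _ _ _ _ f0 xie xiJ hu).
rewrite (gh_trace_horizontal _ _ _ _ f0 xie xiJ hu).
have fN0 : f != 0 by exact: lt0r_neq0.
have -> : 0 + (1 + s / (2 * f)) * (f^-1 * (3%:R - 1)) - s / 2 * f ^- 3 * f -
  f ^- 2 / 2 * (0 + 0) = (4 * f + s) / (2 * f ^+ 2) by field.
by rewrite divr_gt0// mulr_gt0// exprn_gt0.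
Qed.

(** * Tangent vectors and mean curvature in a slice chart *)

Lemma tangent_frame_max {R : realType} {n : nat} (a : 'rV[R]_n) :
  (a *m tangent_frame R n) 0 ord_max = 0.
Proof.
rewrite mxE big1// => i _; rewrite mxE.
by rewrite (negbTE (neq_lift _ _)) mulr0.
Qed.

Lemma tangent_frame_lift {R : realType} {n : nat} (a : 'rV[R]_n) i :
  (a *m tangent_frame R n) 0 (lift ord_max i) = a 0 i.
Proof.
rewrite mxE (bigD1 i)//= mxE eqxx mulr1 big1 ?addr0// => j ji.
by rewrite mxE (inj_eq lift_inj) eq_sym (negbTE ji) mulr0.
Qed.

Lemma row_tangent_frame {R : realType} {n : nat} (i : 'I_n) :
  row i (tangent_frame R n) = delta_mx 0 (lift ord_max i).
Proof. by apply/rowP => j; rewrite !mxE eqxx. Qed.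

Lemma tangent_frame_inj {R : realType} {n : nat} (a : 'rV[R]_n) :
  a != 0 -> a *m tangent_frame R n != 0.
Proof.
apply: contra_neq => /rowP aT; apply/rowP => i.
by rewrite -tangent_frame_lift aT !mxE.
Qed.

Lemma tangent_frameP {R : realType} {n : nat} (v : 'rV[R]_n.+1) :
  v 0 ord_max = 0 -> exists a : 'rV_n, v = a *m tangent_frame R n.
Proof.
move=> v0; exists (\row_i v 0 (lift ord_max i)); apply/rowP => j.
have [i|] := unliftP ord_max j; move=> ->.
  by rewrite tangent_frame_lift mxE.
by rewrite tangent_frame_max.
Qed.

(** The vector [Z] is orthogonal to the hypersurface, so the tangential part subtracted by
    [normal_part] pairs to zero with it. *)
Lemma mean_curvature_normal {R : realType} {n : nat} {X : manifold R n.+1}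
    (g : riemannian_metric X) (c : chart R n.+1 X) (x : X) (Z : 'rV[R]_n.+1) :
  tangent_frame R n *m gmat g c x *m Z^T = 0 -> (gmat g c x)^T = gmat g c x ->
  (mean_curvature g c x *m gmat g c x *m Z^T) 0 0 =
  \sum_i \sum_j invmx (induced_metric g c x) i j *
    ((\row_a christoffel g c x (lift ord_max i) (lift ord_max j) a)
      *m gmat g c x *m Z^T) 0 0.
Proof.
move=> TZ gsym; rewrite /mean_curvature.
rewrite !mulmx_suml summxE; apply: eq_bigr => i _.
rewrite !mulmx_suml summxE; apply: eq_bigr => j _.
rewrite -!scalemxAl mxE; congr (_ * _ 0 0).
rewrite /second_fund_form /normal_part !mulmxBl -!mulmxA.
by rewrite (mulmxA (tangent_frame R n) (gmat g c x)) TZ !mulmx0 subr0.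
Qed.

(** * Maxima of |proj|^2 on minimal hypersurfaces *)

Lemma dot_suml {R : realType} {n q : nat} (F : 'I_q -> 'rV[R]_n) (z : 'rV[R]_n) :
  dot (\sum_i F i) z = \sum_i dot (F i) z.
Proof. by rewrite /dot mulmx_suml summxE. Qed.

Lemma quad_formE {R : realType} {n : nat} (a : 'rV[R]_n) (B : 'M[R]_n) :
  (a *m B *m a^T) 0 0 = \sum_i \sum_j a 0 i * a 0 j * B i j.
Proof.
rewrite -mulmxA mxE; apply: eq_bigr => i _; rewrite mxE mulr_sumr.
by apply: eq_bigr => j _; rewrite mxE -mulrA [a 0 j * _]mulrC.
Qed.

Section regular_maximum.
Context {R : realType} {k : nat} {p : 'I_k -> 'rV[R]_3} {m : R}.
Context {X : manifold R 4} {g : riemannian_metric X} {proj : X -> 'rV[R]_3}.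
Context {act : R -> X -> X} {eta : chart R 4 X -> X -> 'cV[R]_4}.
Hypotheses (GH : gibbons_hawking p m g proj act eta) (m0 : 0 <= m).
Variables (S : set X) (c : chart R 4 X) (x : X).
Hypotheses (Sc : slice_chart S c) (cx : cdom c x) (Sx : S x).
Hypothesis xp : ~ range p (proj x).
Hypothesis Smax : forall x', S x' ->
  dot (proj x') (proj x') <= dot (proj x) (proj x).

Let ca : atlas c := Sc.1.
Let y := cmap c x.
Let U := proj \o cinv c.
Let N := eta c \o cinv c.
Let D := cmap c @` (cdom c `&` proj @^-1` (~` range p)).
Let T := tangent_frame R 3.
Let w := proj x.
Let f := gh_potential p m w.
Let J := 'J U y.
Let e := N y.
Let s := 'D_w (gh_potential p m) w.

Let Uy : U y = w. Proof. by rewrite /U /y /= cmapK. Qed.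

Let f0 : 0 < f.
Proof. by apply: gh_potential_gt0 => //; exact: (gh_poles GH). Qed.

Let Dnear : \forall z \near y, D z.
Proof. exact: (regular_near GH c x cx xp). Qed.

Let Dy : D y. Proof. exact: nbhs_singleton Dnear. Qed.

Let dU : \forall z \near y, differentiable U z.
Proof. by apply: filterS Dnear => z /(regular_diff GH c ca)[]. Qed.

Let ddU b : differentiable ('D_b U) y.
Proof. by have [] := regular_diff GH c ca y Dy. Qed.

Let dN : differentiable N y.
Proof. by have [] := regular_diff GH c ca y Dy. Qed.

Let UJ a : 'D_a U y = a *m J.
Proof. by rewrite deriveEjacobian//; exact: (nbhs_singleton dU). Qed.

Let gE : gmat g c x = f^-1 *: (e *m e^T) + f *: (J *m J^T).
Proof.
have : gmat g c (cinv c y) = (gh_potential p m (U y))^-1 *: (N y *m (N y)^T)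
  + gh_potential p m (U y) *: ('J U y *m ('J U y)^T) := regular_metric GH c ca y Dy.
by rewrite Uy {1}/y cmapK.
Qed.

Let gpos (v : 'rV[R]_4) : v != 0 -> 0 < (v *m gmat g c x *m v^T) 0 0.
Proof. exact: gmat_pos. Qed.

Let gsym : (gmat g c x)^T = gmat g c x.
Proof. exact: gmat_sym. Qed.

(** A combination of the tangent frame has zero last coordinate, so a short line from [y] along it
    stays in the slice. It therefore runs inside [S], where [x] is a maximum. *)
Let at_max (a : 'rV[R]_3) :
  dot ('D_(a *m T) U y) w = 0 /\
  dot ('D_(a *m T) ('D_(a *m T) U) y) w
    + dot ('D_(a *m T) U y) ('D_(a *m T) U y) <= 0.
Proof.
have := sqr_norm_at_max U y (a *m T) dU (ddU _); rewrite Uy; apply.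
have : \forall t \near (0 : R), D (y + t *: (a *m T)) by exact: line_cvg Dnear.
apply: filterS => t [x' [cx' px'] xE].
rewrite -xE /U /= cmapK//; apply: Smax.
apply/(Sc.2 _ cx'); rewrite xE mxE [X in _ + X]mxE tangent_frame_max mulr0 addr0.
exact/(Sc.2 _ cx).
Qed.

Let h := induced_metric g c x.

Let hE : h = f^-1 *: ((T *m e) *m (T *m e)^T) + f *: ((T *m J) *m (T *m J)^T).
Proof.
rewrite /h /induced_metric gE -/T mulmxDr mulmxDl -!scalemxAr -!scalemxAl.
by rewrite !trmx_mul !mulmxA.
Qed.

Let hpos (v : 'rV[R]_3) : v != 0 -> 0 < (v *m h *m v^T) 0 0.
Proof.
move=> /tangent_frame_inj/gpos; rewrite -/T /h /induced_metric -/T.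
by rewrite trmx_mul !mulmxA.
Qed.

Let rankJ : \rank J = 3 /\ exists2 xi : 'rV_4, xi *m e = 1%:M & xi *m J = 0.
Proof.
by apply: (gh_vertical f) => // v /gpos; rewrite gE.
Qed.

(** Over the origin the second-order condition says that the derivative of [U] vanishes on all
    tangent vectors. The induced metric would then be a multiple of the square of [T *m e], of rank
    at most 1 instead of 3. *)
Lemma regular_max_neq0 : w != 0.
Proof.
apply/eqP => w0.
have TJ0 : T *m J = 0.
  apply/row_matrixP => i; rewrite row0 rowE mulmxA -UJ.
  have [_] := at_max (delta_mx 0 i); rewrite w0 {1}dotC {1}/dot mul0mx mxE add0r.
  move=> le0; apply/eqP; rewrite -dot_eq0 eq_le le0; exact: dot_ge0.
have := mxrank_unit (posdef_unitmx _ hpos).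
rewrite hE TJ0 mul0mx scaler0 addr0 scalemxAl => r3.
have := mxrankM_maxr (f^-1 *: (T *m e)) (T *m e)^T.
by rewrite r3 => /leq_trans/(_ (rank_leq_row _)).
Qed.

(** The vertical vector is tangent to [S]. Indeed the differential [w *m J^T] of half the squared
    length is nonzero, and by the first-order condition only its last coordinate survives. A
    vertical vector is killed by it and so has zero last coordinate. *)
Let xi_tangent : exists2 xi : 'rV_3, xi *m (T *m e) = 1%:M & xi *m (T *m J) = 0.
Proof.
have [rJ [xi xie xiJ]] := rankJ.
have [a aE] : exists a, xi = a *m T.
  apply: tangent_frameP.
  have wJ : w *m J^T != 0.
    have Jf : row_free J^T by rewrite /row_free mxrank_tr rJ.
    apply: contra_neq regular_max_neq0 => wJ0.
    by apply: (row_free_inj Jf); rewrite wJ0 mul0mx.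
  have wl i : (w *m J^T) 0 (lift ord_max i) = 0.
    have [wi _] := at_max (delta_mx 0 i).
    rewrite mxE -[RHS]wi UJ -!rowE row_tangent_frame -rowE dotE.
    by apply: eq_bigr => l _; rewrite !mxE mulrC.
  have wm : (w *m J^T) 0 ord_max != 0.
    apply: contra_neq wJ => wm; apply/rowP => j; rewrite [RHS]mxE.
    by have [i|] := unliftP ord_max j; move=> ->.
  have : (w *m J^T *m xi^T) 0 0 = 0.
    by rewrite -mulmxA -trmx_mul xiJ trmx0 mulmx0 mxE.
  rewrite mxE (bigD1 ord_max)//= big1 => [|j jm].
    rewrite addr0 [xi^T _ _]mxE => /eqP; rewrite mulf_eq0 (negbTE wm)/= => /eqP//.
  have [i|] := unliftP ord_max j; move=> jE; first by rewrite jE wl mul0r.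
  by rewrite jE eqxx in jm.
by exists a; rewrite mulmxA -aE.
Qed.

(* The g-gradient of |U|^2 / 2 at x. *)
Let Z := w *m J^T *m invmx (gmat g c x).

Let ZE : Z *m e = 0 /\ Z *m J = f^-1 *: w.
Proof.
have [rJ [xi xie xiJ]] := rankJ.
have gu := posdef_unitmx _ gpos; rewrite gE in gu.
by rewrite /Z gE; exact: (gh_gradient _ _ _ _ f0 xie xiJ gu).
Qed.

Let gZ : gmat g c x *m Z^T = J *m w^T.
Proof.
rewrite -{1}gsym -trmx_mul /Z mulmxKV; first by rewrite trmx_mul trmxK.
exact: posdef_unitmx gpos.
Qed.

Let H := hodge_d (gh_potential p m) w.

(** The curvature equation on [a] and the gradient [Z], whose projection is [f^-1 *: w]. *)
Let curvature (a : 'rV[R]_4) :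
  (Z *m 'D_a N y) 0 0 - (a *m 'D_Z N y) 0 0 = f^-1 * (a *m (J *m (H *m w^T))) 0 0.
Proof.
rewrite [LHS](ext_deriv_form eta c x a Z dN) (gh_curvature GH ca cx xp).
rewrite -/J -/H /chart_jac -/U -/y -/J !mulmxA -mulmxA -trmx_mul ZE.2.
by rewrite linearZ/= -scalemxAr mxE.
Qed.

Let form (a b z : 'rV[R]_4) : R := (a *m gmat g c (cinv c z) *m b^T) 0 0.

Let formE (a b v : 'rV[R]_4) : 'D_v (form a b) y =
  'D_v (fun z => (gh_potential p m (U z))^-1 * ((a *m N z) 0 0 * (b *m N z) 0 0)
     + gh_potential p m (U z) * dot ('D_a U z) ('D_b U z)) y.
Proof.
apply: near_eq_derive; near=> z.
have Dz : D z by near: z.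
have dUz : differentiable U z by near: z.
rewrite /form (regular_metric GH c ca z Dz) gh_form.
by rewrite !(@deriveEjacobian _ _ _ U).
Unshelve. all: by end_near. Qed.

Let t (i : 'I_3) := row i T.

Let tE i : t i = delta_mx 0 (lift ord_max i).
Proof. exact: row_tangent_frame. Qed.

(* The covariant derivative of d_j along d_i, applied to |U|^2 / 2. *)
Let M : 'M[R]_3 := \matrix_(i, j)
  ((\row_a christoffel g c x (lift ord_max i) (lift ord_max j) a)
    *m gmat g c x *m Z^T) 0 0.

Let Ut i : dot ('D_(t i) U y) w = 0.
Proof. by have [] := at_max (delta_mx 0 i); rewrite -rowE. Qed.

Let ME i j : M i j =
  2^-1 * (f^-1 * ((t j *m e) 0 0 * (f^-1 * (t i *m (J *m (H *m w^T))) 0 0)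
                + (t i *m e) 0 0 * (f^-1 * (t j *m (J *m (H *m w^T))) 0 0))
    + 2 * dot ('D_(t i) ('D_(t j) U) y) w
    + f ^- 3 * s * ((t i *m e) 0 0 * (t j *m e) 0 0)
    - f^-1 * s * dot ('D_(t i) U y) ('D_(t j) U y)).
Proof.
rewrite mxE (koszul g c x ca cx) -!tE !formE; congr (_ * _).
have dphi : differentiable (gh_potential p m) (U y).
  by rewrite Uy; exact: gh_potential_diff.
have fy : gh_potential p m (U y) != 0 by rewrite Uy lt0r_neq0.
have ZN : (Z *m N y) 0 0 = 0 by rewrite ZE.1 mxE.
have UZ : 'D_Z U y = (gh_potential p m (U y))^-1 *: w by rewrite UJ ZE.2 Uy.
have := koszul_gibbons_hawking U N (gh_potential p m) y dU ddU dN dphi fy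
  (t i) (t j) Z w ZN UZ (Ut i) (Ut j).
rewrite Uy => K; apply: etrans K _.
by congr (_ * (_ * _ + _ * _) + _ + _ - _); exact: curvature.
Qed.

(** The ordinary second derivatives of half the squared length of [U], in the slice coordinates of
    [S]. *)
Let B : 'M[R]_3 := \matrix_(i, j)
  (dot ('D_(t i) ('D_(t j) U) y) w + dot ('D_(t i) U y) ('D_(t j) U y)).

(** [B - M] is the Hessian for [g] of half the squared length, restricted to the tangent space. The
    second derivatives of [U] cancel in it, and the curvature enters only through the mixed
    terms. *)
Let BE : B = M + (1 + s / (2 * f)) *: ((T *m J) *m (T *m J)^T)
  - (s / 2 * f ^- 3) *: ((T *m e) *m (T *m e)^T)
  - (f ^- 2 / 2) *: ((T *m e) *m ((T *m J) *m (H *m w^T))^T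
                     + (T *m J) *m (H *m w^T) *m (T *m e)^T).
Proof.
have fN0 : f != 0 by exact: lt0r_neq0.
have outer (a b : 'cV[R]_3) i j : (a *m b^T) i j = a i 0 * b j 0.
  by rewrite mxE big_ord1 [b^T _ _]mxE.
have rT q (A : 'M[R]_(4, q)) i j : (T *m A) i j = (t i *m A) 0 j.
  by rewrite /t -row_mul [RHS]mxE.
have addE (A1 A2 : 'M[R]_3) i j : (A1 + A2) i j = A1 i j + A2 i j by rewrite mxE.
have oppE (A1 : 'M[R]_3) i j : (- A1) i j = - A1 i j by rewrite mxE.
have scaleE a (A1 : 'M[R]_3) i j : (a *: A1) i j = a * A1 i j by rewrite mxE.
apply/matrixP => i j; rewrite [LHS]mxE !(addE, oppE, scaleE) ME.
rewrite -[T *m J *m (H *m w^T)]mulmxA !outer !rT.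
have -> : (T *m J *m (T *m J)^T) i j = dot ('D_(t i) U y) ('D_(t j) U y).
  rewrite !UJ dotE mxE; apply: eq_bigr => l _.
  by rewrite [(T *m J)^T _ _]mxE !rT.
move: (dot _ _) (dot _ _) => d1 d2.
move: ((t i *m e) 0 0) ((t j *m e) 0 0) => n1 n2.
move: ((t i *m (J *m _)) 0 0) ((t j *m (J *m _)) 0 0) s => z1 z2 s'.
by move: f fN0 => f' fN0; field.
Qed.

Let Bneg (a : 'rV[R]_3) : (a *m B *m a^T) 0 0 <= 0.
Proof.
have [_] := at_max a; rewrite (derive2_mulmx U y a T dU ddU).
have -> : 'D_(a *m T) U y = \sum_i a 0 i *: 'D_(t i) U y.
  by apply: derive_mulmx; exact: (nbhs_singleton dU).
apply: le_trans; rewrite quad_formE !dot_suml -big_split/= le_eqVlt.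
apply/orP; left; apply/eqP; apply: eq_bigr => i _.
rewrite dot_suml (dotC _ (\sum_i0 _)) dot_suml -big_split/=.
apply: eq_bigr => j _; rewrite [B i j]mxE dotZl dotZl dotZr mulrDr.
by rewrite (dotC ('D_(t j) U y)) mulrA [a 0 j * a 0 i]mulrC.
Qed.

(** By the first-order condition the gradient [Z] is normal to [S], so this trace is the mean
    curvature vector paired with [Z]. *)
Let trM : minimal g S -> \tr (invmx h *m M) = 0.
Proof.
move=> Smin; have TZ : T *m gmat g c x *m Z^T = 0.
  rewrite -mulmxA gZ mulmxA; apply/matrixP => i j; rewrite ord1 [RHS]mxE.
  rewrite -[RHS](Ut i) UJ /t -row_mul /dot !mxE.
  by apply: eq_bigr => l _; rewrite [row i _ _ _]mxE.
have := mean_curvature_normal g c x Z TZ gsym.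
rewrite (Smin c x Sc cx Sx) !mul0mx mxE => ->.
rewrite -mxtrace_tr trmx_mul trmx_inv.
have -> : h^T = h by rewrite hE gh_sym.
rewrite mxtrace_mulC; apply: eq_bigr => i _; rewrite mxE.
by apply: eq_bigr => j _; rewrite [M^T _ _]mxE [M _ _]mxE.
Qed.

Lemma no_regular_max : minimal g S ->
  ~ 0 < 4 * gh_potential p m (proj x) + 'D_(proj x) (gh_potential p m) (proj x).
Proof.
move=> Smin; have [xi xie xiJ] := xi_tangent.
exact: (gh_trace_contradiction f s _ _ xi (H *m w^T) h M B f0 xie xiJ hE hpos BE
  (trM Smin) Bneg).
Qed.
End regular_maximum.

(** The ambient dimension [n.+2] leaves at least one tangent direction, and a short move along it in
    a slice chart reaches another point of [S]. *)
Lemma hypersurface_not_point {R : realType} {n : nat} {X : manifold R n.+2}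
    (S : set X) (x : X) : hypersurface S -> S x -> ~ (S `<=` [set x]).
Proof.
move=> hS Sx S1; have [c [ca cS] cx] := hS x Sx.
pose v : 'rV[R]_n.+2 := delta_mx 0 0 *m tangent_frame R n.+1.
have v0 : v != 0.
  apply: tangent_frame_inj; apply/eqP => /rowP/(_ 0).
  by rewrite !mxE eqxx; apply/eqP/oner_neq0.
have : \forall t \near (0 : R), (cmap c @` cdom c) (cmap c x + t *: v).
  apply: line_cvg; apply: open_nbhs_nbhs; split; first exact: cimg_open.
  by exists x.
move=> /nbhs_ballP[r /= r0 /(_ (r / 2))].
rewrite /ball/= sub0r normrN gtr0_norm ?divr_gt0// ltr_pdivrMr// mulr_natr.
rewrite mulr2n ltrDl r0 => /(_ isT)[x' cx' xE].
have /S1 xx : S x'.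
  apply/(cS _ cx'); rewrite xE mxE [X in _ + X]mxE tangent_frame_max mulr0 addr0.
  exact/(cS _ cx).
move: xE; rewrite xx => /eqP; rewrite eq_sym -subr_eq0 addrC addKr scaler_eq0.
by rewrite (negbTE v0) orbF gt_eqF// divr_gt0.
Qed.

(** * Locating the maximum on a compact minimal hypersurface *)

Section compact_minimal.
Context {R : realType} {k : nat} {p : 'I_k -> 'rV[R]_3} {m : R}.
Context {X : manifold R 4} {g : riemannian_metric X} {proj : X -> 'rV[R]_3}.
Context {act : R -> X -> X} {eta : chart R 4 X -> X -> 'cV[R]_4}.
Hypotheses (GH : gibbons_hawking p m g proj act eta) (m0 : 0 <= m).
Context {S : set X}.
Hypothesis cmS : compact_minimal_hypersurface g S.

Lemma exists_max_norm : S !=set0 -> exists2 x, S x &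
  forall x', S x' -> dot (proj x') (proj x') <= dot (proj x) (proj x).
Proof.
have [_ cS _] := cmS => S0.
have [|x xS xmax] := @compact_EVT_max _ _ (fun x => dot (proj x) (proj x)) S S0 cS.
  apply: continuous_subspaceT => x.
  apply: (@continuous_comp _ _ _ proj (fun v => dot v v)).
    exact: (gh_proj_cont GH).
  apply: (@differentiable_continuous _ _ _ _ (fun v => dot v v)).
  exact: differentiable_dot.
exists x; first by rewrite inE in xS.
by move=> x' Sx'; apply: xmax; rewrite inE.
Qed.

Lemma max_norm_pole x : S x ->
  (forall x', S x' -> dot (proj x') (proj x') <= dot (proj x) (proj x)) ->
  (forall i, enorm (proj x) < enorm (p i) \/
     4 / 3 * enorm (p i) < enorm (proj x) \/ p i = 0) ->
  exists i, proj x = p i.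
Proof.
move=> Sx xmax xP; apply: contrapT => xp; have [hS _ mS] := cmS.
have [c Sc cx] := hS x Sx.
have xp' : ~ range p (proj x) by move=> [i _ iE]; apply: xp; exists i.
apply: (no_regular_max GH m0 S c x Sc cx Sx xp' xmax mS).
apply: gh_potential_convex => // [|i]; first exact: (gh_poles GH).
case: (xP i) => [|[|pi0]]; [by left|by right|right].
(* For a pole at the origin the outer inequality becomes [0 < enorm (proj x)], true because a
   regular maximum does not lie over the origin. *)
rewrite pi0 enormE /dot mul0mx mxE sqrtr0 mulr0 enorm_gt0.
exact: (regular_max_neq0 GH S c x Sc cx Sx xp' xmax).
Qed.

End compact_minimal.

Theorem theorem1p2 (R : realType) (k : nat) (p : 'I_k -> 'rV[R]_3)
    (X : manifold R 4) (g : riemannian_metric X) (proj : X -> 'rV[R]_3)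
    (XGH : multi_Eguchi_Hanson p g proj \/ multi_Taub_NUT p g proj) :
  (forall S : set X, compact_minimal_hypersurface g S ->
     S `<=` proj @^-1` [set x : 'rV[R]_3 |
       enorm x <= 4 / 3 * \big[Num.max/0]_(i < k) enorm (p i)]) /\
  ~ (exists S : set X,
       [/\ compact_minimal_hypersurface g S, S !=set0 &
           S `<=` proj @^-1` [set x : 'rV[R]_3 |
             ((enorm x)%:E <
              \big[Order.min/+oo]_(i < k | (0 < enorm (p i))%R) (enorm (p i))%:E)%E]]).
Proof.
have [m [act [eta [m0 GH]]]] : exists m act eta,
    0 <= m /\ gibbons_hawking p m g proj act eta.
  case: XGH => [[act [eta GH]]|[m m0 [act [eta GH]]]].
    by exists 0, act, eta.
  by exists m, act, eta; split=> //; exact: ltW.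
split=> [S cmS x Sx /=|[S [cmS S0 Smin]]].
  have [x1 Sx1 x1max] := exists_max_norm GH cmS (ex_intro _ x Sx).
  rewrite leNgt; apply/negP => xbig.
  have big i : 4 / 3 * enorm (p i) < enorm (proj x1).
    have le1 : enorm (proj x) <= enorm (proj x1).
      by rewrite !enormE ler_wsqrtr// x1max.
    apply: lt_le_trans le1; apply: le_lt_trans xbig.
    by rewrite ler_pM2l// (le_bigmax 0 (fun i => enorm (p i)) i).
  (* The maximum would lie over a pole whose norm exceeds [4 / 3] times itself. *)
  have [|i x1E] := max_norm_pole GH m0 cmS x1 Sx1 x1max; first by right; left.
  have := big i; rewrite x1E; have := enorm_ge0 (p i).
  by move: (enorm _) => r; lra.
have [x1 Sx1 x1max] := exists_max_norm GH cmS S0.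
(* Only poles off the origin enter the minimum. A pole at the origin is handled by the third
   alternative of [max_norm_pole]. *)
have small i : 0 < enorm (p i) -> enorm (proj x1) < enorm (p i).
  move=> pi0; rewrite -lte_fin; apply: (lt_le_trans (Smin x1 Sx1)).
  exact: (bigmin_le_cond _ (fun i => (enorm (p i))%:E)).
have [i|i x1E] := max_norm_pole GH m0 cmS x1 Sx1 x1max.
  have [->|pi0] := eqVneq (p i) 0; first by right; right.
  by left; apply: small; rewrite enorm_gt0.
(* The pole below [x1] is the origin, since [small] would make any other pole strictly longer than
   itself. *)
have x10 : proj x1 = 0.
  apply/eqP/negPn/negP => pN0; have := small i.
  by rewrite -x1E enorm_gt0 ltxx => /(_ pN0).
have [x2 fib] := gh_added GH i.
(* The maximal length is 0, so [S] lies over this pole, whose fibre is a single added point; a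
   hypersurface cannot be that small. *)
have fib1 x : S x -> x = x2.
  move=> Sx; have : proj x = p i.
    rewrite -x1E x10; apply/eqP; rewrite -dot_eq0 eq_le dot_ge0 andbT.
    by apply: le_trans (x1max x Sx) _; rewrite x10 /dot mul0mx mxE.
  by rewrite -[proj x = p i]/((proj @^-1` [set p i]) x) fib.
have [hS _ _] := cmS; apply: (hypersurface_not_point S x1 hS Sx1).
by move=> x Sx /=; rewrite (fib1 x1 Sx1); exact: fib1.
Qed.
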